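(* Let $E/\mathbb Q(t)$ be $y^2=x^3-t^2x+t^2$. Let $T$ be the set of integers $t_0>2$ which are not of any of the following four forms for any $n\in\mathbb Z$: (1) $64(uv^3+3v^4)$ with $u=\frac{(1+\sqrt2)^{2n}+(1-\sqrt2)^{2n}}{2}$, $v=\frac{(1+\sqrt2)^{2n}-(1-\sqrt2)^{2n}}{4\sqrt2}$; (2) $4(uv^3+3v^4)$ with $u=(1+\sqrt2)^{2n+1}+(1-\sqrt2)^{2n+1}$, $v=\frac{(1+\sqrt2)^{2n+1}-(1-\sqrt2)^{2n+1}}{2\sqrt2}$; (3) $uv^3+3v^4$ with $u=\sqrt2\big((1+\sqrt2)^{2n+1}-(1-\sqrt2)^{2n+1}\big)$, $v=\frac{(1+\sqrt2)^{2n+1}+(1-\sqrt2)^{2n+1}}{2}$; (4) $uv^3+3v^4$ with $u=\sqrt2\big((1+\sqrt2)^{2n}-(1-\sqrt2)^{2n}\big)$, $v=\frac{(1+\sqrt2)^{2n}+(1-\sqrt2)^{2n}}{2}$. Then $T\subseteq\mathbb N$ has natural density $1$, and for each $t_0\in T$ the specialization map $\sigma_{t_0}:E(\mathbb Q(t))\to E_{t_0}(\mathbb Q)$ is injective.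
   Context: $E_{t_0}$ is the elliptic curve $y^2=x^3-t_0^2x+t_0^2$ over $\mathbb Q$ and $\sigma_{t_0}$ is the specialization homomorphism $(x(t),y(t))\mapsto(x(t_0),y(t_0))$. The natural density of $T\subseteq\mathbb N$ is $\lim_{n\to\infty}\#\{k\in T:k\le n\}/n$. *)

(* Defs.v *)
From HB Require Import structures.
From mathcomp Require Import all_boot all_order all_algebra all_field.
From mathcomp Require Import boolp.
Set Implicit Arguments. Unset Strict Implicit. Unset Printing Implicit Defensive.
Import Order.TTheory GRing.Theory Num.Theory.
Local Open Scope ring_scope.

Definition Qt := {fraction {poly rat}}.
Definition tQ : Qt := FracField.tofrac 'X.

(* Points of E : y^2 = x^3 - t^2 x + t^2 over Q(t); None = point at infinity. *)
Definition on_E_Qt (P : option (Qt * Qt)) : Prop :=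
  match P with
  | None => True
  | Some (x, y) => y ^+ 2 = x ^+ 3 - tQ ^+ 2 * x + tQ ^+ 2
  end.

Definition rnum (f : Qt) : {poly rat} :=
  let r := repr f in \n_r %/ gcdp \n_r \d_r.
Definition rden (f : Qt) : {poly rat} :=
  let r := repr f in \d_r %/ gcdp \n_r \d_r.

Definition regular_at (t0 : rat) (f : Qt) : bool := (rden f).[t0] != 0.
(* value of f at t0 (meaningful when regular_at t0 f) *)
Definition eval_at (t0 : rat) (f : Qt) : rat := (rnum f).[t0] / (rden f).[t0].

Definition sigma (t0 : rat) (P : option (Qt * Qt)) : option (rat * rat) :=
  match P with
  | None => None
  | Some (x, y) =>
      if regular_at t0 x && regular_at t0 y
      then Some (eval_at t0 x, eval_at t0 y) else None
  end.

Definition s2 : algC := sqrtC 2.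
Definition a_p (m : int) : algC := (1 + s2) ^ m.
Definition a_m (m : int) : algC := (1 - s2) ^ m.
Definition fuv (u v : algC) : algC := u * v ^+ 3 + 3 * v ^+ 4.

Definition form1 (n : int) : algC :=
  let u := (a_p (2 * n) + a_m (2 * n)) / 2 in
  let v := (a_p (2 * n) - a_m (2 * n)) / (4 * s2) in 64 * fuv u v.
Definition form2 (n : int) : algC :=
  let u := a_p (2 * n + 1) + a_m (2 * n + 1) in
  let v := (a_p (2 * n + 1) - a_m (2 * n + 1)) / (2 * s2) in 4 * fuv u v.
Definition form3 (n : int) : algC :=
  let u := s2 * (a_p (2 * n + 1) - a_m (2 * n + 1)) in
  let v := (a_p (2 * n + 1) + a_m (2 * n + 1)) / 2 in fuv u v.
Definition form4 (n : int) : algC :=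
  let u := s2 * (a_p (2 * n) - a_m (2 * n)) in
  let v := (a_p (2 * n) + a_m (2 * n)) / 2 in fuv u v.

Definition inT (t0 : nat) : Prop :=
  (2 < t0)%N /\
  ~ (exists n : int, let x := (t0%:R : algC) in
       x = form1 n \/ x = form2 n \/ x = form3 n \/ x = form4 n).

Definition countT (n : nat) : nat := \sum_(k < n.+1) (asbool (inT k) : nat).

Definition has_density (d : rat) : Prop :=
  forall eps : rat, 0 < eps -> exists N : nat, forall n : nat, (N <= n)%N ->
    `| (countT n)%:R / n%:R - d | < eps.

(* Main.v *)
(* Put w = 1/t and x = X/w: the curve becomes Y^2 = w (X^3 - X + w), and a root s
   of X^3 - X + w generates a rational function field Q(s), with w = s - s^3.
   A nonzero point of the kernel of specialization is X = A/B, with A and B coprime in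
   Q[w] and B(w0) = 0 at w0 = 1/t0.  In the 2-descent the class of A - sB in
   Q(s)^*/Q(s)^*2 is supported on s, s - 1, s + 1 and the ramification 3s^2 - 1.
   Since t0 > 2, w = s - s^3 has three real solutions over w0, at which A - sB takes
   the same nonzero value A(w0); comparing signs leaves, up to constants, only the
   classes 1, w, s - 1 and s(s + 1).
   The class w contradicts coprimality.  For s - 1 and s(s + 1), specializing at w0
   makes 1 - s0 a constant times a square in Q(s0), i.e. (t0, t0) is divisible by 2 on
   E_t0; this leads to t^2 - (6m^2 + 8m)t + m^4 = 0 with m integral, hence to Pell's
   equation and to the four excluded forms.  The trivial class means that the point
   is twice a point of smaller degree which still lies in the kernel: descent.
   For the density, a value t of one of the forms is at least v^2, where the
   integer v determines t up to eight choices. *)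
Require Import Defs.
From mathcomp Require Import all_boot all_order all_algebra all_field.
From mathcomp Require Import boolp realalg ring lra zify.
From Stdlib Require PeanoNat.
Import Order.TTheory GRing.Theory Num.Theory.
Local Open Scope ring_scope.

(** * Squares and divisors of polynomials *)

(** With g = gcd(u, r), coprimality makes u/g and g divide each other, so u is g^2 up to a
    constant. *)
Lemma coprimep_mul_sqr (F : fieldType) (u v r : {poly F}) :
  u != 0 -> coprimep u v -> u * v = r ^+ 2 ->
  exists c g, c != 0 /\ u = c *: g ^+ 2.
Proof.
move=> u0 cuv uvr; pose g := gcdp u r.
have g0 : g != 0 by rewrite gcdp_eq0 (negPf u0).
have Eu : u = (u %/ g) * g by rewrite divpK // dvdp_gcdl.
have Er : r = (r %/ g) * g by rewrite divpK // dvdp_gcdr.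
have cop : coprimep (u %/ g) (r %/ g) by rewrite coprimep_div_gcd // u0.
set u' := u %/ g in Eu cop; set r' := r %/ g in Er cop.
have E : u' * v = r' ^+ 2 * g.
  by apply: (mulIf g0); rewrite mulrAC -Eu uvr {1}Er; ring.
have d1 : u' %| g.
  rewrite -(@Gauss_dvdpr _ _ (r' ^+ 2)) -?E ?dvdp_mulr //.
  by rewrite coprimep_expr.
have d2 : g %| u'.
  rewrite -(@Gauss_dvdpl _ _ v) ?E ?dvdp_mull //.
  by rewrite (coprimep_dvdr (dvdp_gcdl u r)) // coprimep_sym.
have /eqpP [[c1 c2] /= /andP[c10 c20] Ec] : u' %= g by rewrite /eqp d1 d2.
exists (c1^-1 * c2), g; split; first by rewrite mulf_neq0 ?invr_eq0.
by rewrite expr2 scalerAl -scalerA -Ec scalerA mulVf // scale1r.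
Qed.

(** Source of finiteness in the 2-descent: a factor of a square has the square class, up to
    constants, of its gcd with the cofactor. Dividing both factors by the gcd reduces to the coprime
    case. *)
Lemma mul_sqr_gcdp (F : fieldType) (f h r : {poly F}) :
  f != 0 -> f * h = r ^+ 2 ->
  exists c g, c != 0 /\ f = c *: (gcdp f h * g ^+ 2).
Proof.
move=> f0 fhr; pose k := gcdp f h.
have k0 : k != 0 by rewrite gcdp_eq0 (negPf f0).
have Ef : f = (f %/ k) * k by rewrite divpK // dvdp_gcdl.
have Eh : h = (h %/ k) * k by rewrite divpK // dvdp_gcdr.
have cop : coprimep (f %/ k) (h %/ k) by rewrite coprimep_div_gcd // f0.
have f'0 : f %/ k != 0 by apply: contra_neq f0 => E; rewrite Ef E mul0r.
have Er : r = (r %/ k) * k.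
  by rewrite divpK // -(@dvdp_pexp2r _ _ _ 2) // -fhr expr2 dvdp_mul ?dvdp_gcdl ?dvdp_gcdr.
have E : (f %/ k) * (h %/ k) = (r %/ k) ^+ 2.
  apply: (mulIf k0); apply: (mulIf k0).
  transitivity ((f %/ k * k) * (h %/ k * k)); first by ring.
  by rewrite -Ef -Eh fhr {1}Er; ring.
have [c [g [c0 Eg]]] := coprimep_mul_sqr _ _ _ _ f'0 cop E.
by exists c, g; split=> //; rewrite {1}Ef Eg -scalerAl mulrC.
Qed.

Lemma dvdp_irred_mul (F : fieldType) (l m d : {poly F}) :
  irreducible_poly l -> d %| l * m ->
  exists (b : bool) d', d = l ^+ b * d' /\ d' %| m.
Proof.
move=> il dlm; have l0 : l != 0 by apply: irredp_neq0.
case E : (l %| d).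
  exists true, (d %/ l); rewrite expr1 mulrC divpK //; split=> //.
  by rewrite -(dvdp_mul2l _ _ l0) mulrC divpK.
exists false, d; rewrite expr0 mul1r; split=> //.
move: dlm; rewrite Gauss_dvdpr // coprimep_sym.
by rewrite irreducible_poly_coprime // E.
Qed.

Lemma irreducible_XaddC (F : fieldType) (c : F) : irreducible_poly ('X + c%:P).
Proof.
split=> [|q q1 qd]; first by rewrite size_XaddC.
have X0 : 'X + c%:P != 0 by rewrite -size_poly_eq0 size_XaddC.
rewrite -(dvdp_size_eqp qd) size_XaddC.
have := dvdp_leq X0 qd; rewrite size_XaddC leq_eqVlt => /orP[//|].
have : size q != 0%N by rewrite size_poly_eq0; apply: contraTneq qd => ->; rewrite dvd0p.
by move: (size q) q1 => [|[|]].
Qed.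

(** Serves for identities in w = 1/t, which can only be tested at nonzero points; a nonzero
    difference would have too many roots among 1, 2, 3, ... *)
Lemma poly_eq_nz_eval (F : numFieldType) (p q : {poly F}) :
  (forall x, x != 0 -> p.[x] = q.[x]) -> p = q.
Proof.
move=> pq; apply/eqP; rewrite -subr_eq0; apply/negPn/negP => n0.
pose s := [seq (i.+1)%:R : F | i <- iota 0 (size (p - q))].
have := max_poly_roots n0 (rs := s).
rewrite size_map size_iota ltnn; suff: all (root (p - q)) s && uniq s.
  by case/andP => rs us /(_ rs us).
apply/andP; split.
  apply/allP => x /mapP[i _ ->]; rewrite rootE hornerD hornerN pq ?subrr //.
  by rewrite pnatr_eq0.
rewrite map_inj_uniq ?iota_uniq // => i j /eqP.
by rewrite eqr_nat => /eqP[].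
Qed.

Lemma poly_eqmul_sqr (F : fieldType) (d p r : {poly F}) :
  d != 0 -> p * d ^+ 2 = r ^+ 2 -> exists q, p = q ^+ 2 /\ r = q * d.
Proof.
move=> d0 E; have dr : d %| r.
  by rewrite -(@dvdp_pexp2r _ _ _ 2) // -E dvdp_mulIr.
exists (r %/ d); rewrite divpK //; split=> //.
by apply: (mulIf (expf_neq0 2 d0)); rewrite E -{1}(divpK dr) exprMn.
Qed.

Lemma coprimep_no_common_root (F : fieldType) (A B : {poly F}) (w : F) :
  coprimep A B -> B.[w] = 0 -> A.[w] != 0.
Proof.
move=> cAB Bw; apply/negP => rA; have : root (gcdp A B) w by rewrite root_gcd /root rA Bw eqxx.
move: cAB; rewrite /coprimep => /size_poly1P[z z0 ->].
by rewrite /root hornerC (negPf z0).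
Qed.

(** * The cubic extension Q(s) of Q(w) *)

(* w as a polynomial in s; a polynomial p in w is p \Po wpoly when viewed in s. *)
Definition wpoly : {poly rat} := 'X - 'X^3.

(** Q[s] is free over Q[w] with basis 1, s, s^2; these are coordinates in that basis. *)
Definition of_coords (g0 g1 g2 : {poly rat}) : {poly rat} :=
  (g0 \Po wpoly) + 'X * (g1 \Po wpoly) + 'X^2 * (g2 \Po wpoly).

Lemma size_wpoly : size wpoly = 4.
Proof. by rewrite /wpoly addrC size_polyDl size_polyN ?size_polyX ?size_polyXn. Qed.

Lemma size_comp_wpoly (p : {poly rat}) :
  size (p \Po wpoly) = (if p == 0 then 0%N else ((size p).-1 * 3).+1).
Proof.
have [->|p0] := eqVneq p 0; first by rewrite comp_poly0 size_poly0.
have -> : ((size p).-1 * 3 = (size (p \Po wpoly)).-1)%N by rewrite size_comp_poly size_wpoly.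
rewrite prednK //.
by rewrite lt0n size_poly_eq0 comp_poly_eq0 // size_wpoly.
Qed.

Lemma size_addp_neq (R : nzRingType) (p q : {poly R}) :
  (size p == size q -> p = 0 /\ q = 0) -> size (p + q) = maxn (size p) (size q).
Proof.
have [/eqP e|e _] := eqVneq (size p) (size q).
  by move/(_ isT) => [-> ->]; rewrite addr0 size_poly0.
by move: e; rewrite neq_ltn => /orP[] l; [rewrite addrC|]; rewrite size_polyDl //;
  symmetry; [apply/maxn_idPr|apply/maxn_idPl]; apply: ltnW.
Qed.

(* The three summands have distinct degrees mod 3. *)
Lemma size_of_coords g0 g1 g2 :
  size (of_coords g0 g1 g2) = maxn (maxn (size (g0 \Po wpoly))
    (size ('X * (g1 \Po wpoly)))) (size ('X^2 * (g2 \Po wpoly))).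
Proof.
have S1 p : size ('X * (p \Po wpoly)) = (if p == 0 then 0%N else ((size p).-1 * 3).+2).
  have [->|p0] := eqVneq p 0; first by rewrite comp_poly0 mulr0 size_poly0.
  rewrite mulrC size_mulX ?comp_poly_eq0 ?size_wpoly // size_comp_wpoly.
  by rewrite (negPf p0).
have S2 p : size ('X^2 * (p \Po wpoly)) = (if p == 0 then 0%N else ((size p).-1 * 3).+3).
  have [->|p0] := eqVneq p 0; first by rewrite comp_poly0 mulr0 size_poly0.
  by rewrite expr2 -mulrA mulrC size_mulX ?S1 ?(negPf p0) // -size_poly_eq0 S1 (negPf p0).
have E1 : size ((g0 \Po wpoly) + 'X * (g1 \Po wpoly)) =
    maxn (size (g0 \Po wpoly)) (size ('X * (g1 \Po wpoly))).
  apply: size_addp_neq; rewrite size_comp_wpoly S1.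
  have [->|n0] := eqVneq g0 0; have [->|n1] := eqVneq g1 0 => //= /eqP.
  - by rewrite comp_poly0 mulr0.
  - by lia.
rewrite /of_coords size_addp_neq E1 //.
rewrite size_comp_wpoly S1 S2.
have [->|n0] := eqVneq g0 0; have [->|n1] := eqVneq g1 0;
  have [->|n2] := eqVneq g2 0 => //= /eqP; try lia.
by rewrite comp_poly0 !mulr0 addr0.
Qed.

Lemma comp_polyN (p q : {poly rat}) : (- p) \Po q = - (p \Po q).
Proof. exact: raddfN. Qed.

Lemma comp_poly_nat (n : nat) (q : {poly rat}) : n%:R \Po q = n%:R.
Proof. by rewrite -polyC_natr comp_polyC. Qed.

Definition comp_polyE_ring :=
  (comp_polyN, comp_polyD, comp_polyM, comp_polyX, comp_polyC, comp_Xn_poly,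
   comp_polyZ, comp_poly_nat).

Lemma of_coords_surj (g : {poly rat}) : exists g0 g1 g2, g = of_coords g0 g1 g2.
Proof.
elim/poly_ind: g => [|g c [g0 [g1 [g2 ->]]]].
  by exists 0, 0, 0; rewrite /of_coords !comp_poly0 !mulr0 !addr0.
(* Coordinates of s g + c, reduced by s^3 = s - w. *)
exists (c%:P - 'X * g2), (g0 + g2), g1; rewrite /of_coords.
by rewrite !comp_polyE_ring /wpoly; ring.
Qed.

Lemma of_coordsB g0 g1 g2 h0 h1 h2 :
  of_coords g0 g1 g2 - of_coords h0 h1 h2 = of_coords (g0 - h0) (g1 - h1) (g2 - h2).
Proof. by rewrite /of_coords !comp_polyB; ring. Qed.

Lemma of_coords_inj g0 g1 g2 h0 h1 h2 :
  of_coords g0 g1 g2 = of_coords h0 h1 h2 -> [/\ g0 = h0, g1 = h1 & g2 = h2].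
Proof.
move/eqP; rewrite -subr_eq0 of_coordsB -size_poly_eq0 size_of_coords.
rewrite -leqn0 !geq_max !leqn0 !size_poly_eq0 !mulf_eq0 !polyX_eq0 /=.
rewrite !comp_poly_eq0 ?size_wpoly // !subr_eq0.
by case/andP => /andP[/eqP -> /eqP ->] /eqP ->.
Qed.

Lemma of_coordsZ c g0 g1 g2 :
  c *: of_coords g0 g1 g2 = of_coords (c *: g0) (c *: g1) (c *: g2).
Proof. by rewrite /of_coords !comp_polyZ !scalerDr !scalerAr. Qed.

(* Coordinates of the square of a + b s + c s^2, where s^3 = s - w. *)
Definition sqr_coord0 {R : pzRingType} (w a b c : R) : R := a ^+ 2 - 2 * b * c * w.
Definition sqr_coord1 {R : pzRingType} (w a b c : R) : R := 2 * a * b + 2 * b * c - c ^+ 2 * w.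
Definition sqr_coord2 {R : pzRingType} (a b c : R) : R := b ^+ 2 + 2 * a * c + c ^+ 2.

Lemma of_coords_sqr g0 g1 g2 :
  of_coords g0 g1 g2 ^+ 2 =
  of_coords (sqr_coord0 'X g0 g1 g2) (sqr_coord1 'X g0 g1 g2) (sqr_coord2 g0 g1 g2).
Proof.
rewrite /of_coords /sqr_coord0 /sqr_coord1 /sqr_coord2 !exprS !expr0 !mulr1.
rewrite !comp_polyE_ring /wpoly; ring.
Qed.

Lemma of_coordsX g0 g1 g2 :
  'X * of_coords g0 g1 g2 = of_coords (- ('X * g2)) (g0 + g2) g1.
Proof.
by rewrite /of_coords !comp_polyE_ring /wpoly; ring.
Qed.

Lemma of_coords_wpoly g0 g1 g2 :
  wpoly * of_coords g0 g1 g2 = of_coords ('X * g0) ('X * g1) ('X * g2).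
Proof. by rewrite /of_coords !comp_polyE_ring; ring. Qed.

Lemma of_coordsD g0 g1 g2 h0 h1 h2 :
  of_coords g0 g1 g2 + of_coords h0 h1 h2 = of_coords (g0 + h0) (g1 + h1) (g2 + h2).
Proof. by rewrite /of_coords !comp_polyE_ring; ring. Qed.

(** * The square class of A - sB *)

(** On [0, 1] the function s - s^3 peaks at z = 1/sqrt 3 with value 2/(3 sqrt 3) > 1/3, so w is
    attained on both sides of z; the third root lies in (-2, -1). *)
Lemma real_fiber (R : rcfType) (w : R) : 0 < w -> 3 * w <= 1 ->
  exists s1 s2 s3 : R,
    [/\ [/\ s1 - s1 ^+ 3 = w, s2 - s2 ^+ 3 = w & s3 - s3 ^+ 3 = w],
        0 < s1 < 1 /\ 3 * s1 ^+ 2 < 1, 0 < s2 < 1 /\ 1 < 3 * s2 ^+ 2 & s3 < -1].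
Proof.
move=> w_gt0 w_le3; pose p : {poly R} := 'X^3 - 'X + w%:P.
have pE x : p.[x] = x ^+ 3 - x + w by rewrite /p !hornerE.
have pR x : root p x -> x - x ^+ 3 = w.
  by move/rootP; rewrite pE => E; lra.
pose z : R := Num.sqrt (3^-1).
have z2 : z ^+ 2 = 3^-1 by rewrite sqr_sqrtr // invr_ge0.
have z0 : 0 <= z by apply: sqrtr_ge0.
have z1 : z < 1 by nra.
have zh : 1 < 2 * z by nra.
have pz : p.[z] < 0 by rewrite pE exprS z2; lra.
have p0 : 0 < p.[0] by rewrite pE expr0n /=; lra.
have p1 : 0 < p.[1] by rewrite pE expr1n; lra.
have pm1 : 0 < p.[-1] by rewrite pE !exprS expr0; lra.
have pm2 : p.[-2] < 0 by rewrite pE !exprS expr0; lra.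
have pos1 : (- p).[0] <= 0 <= (- p).[z] by rewrite !hornerN oppr_le0 oppr_ge0 !ltW.
have pos2 : p.[z] <= 0 <= p.[1] by rewrite !ltW.
have pos3 : p.[-2] <= 0 <= p.[-1] by rewrite !ltW.
have [s1 /andP[a1 b1]] := poly_ivt z0 pos1.
rewrite rootN => r1.
have [s2 /andP[a2 b2] r2] := poly_ivt (ltW z1) pos2.
have le3 : -2 <= -1 :> R by lra.
have [s3 /andP[a3 b3] r3] := poly_ivt le3 pos3.
have nr x y : root p x -> p.[y] != 0 -> x != y by move=> rx; apply: contraNneq => <-.
have n10 := nr _ 0 r1 (lt0r_neq0 p0).
have n1z := nr _ z r1 (ltr0_neq0 pz).
have n2z := nr _ z r2 (ltr0_neq0 pz).
have n21 := nr _ 1 r2 (lt0r_neq0 p1).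
have n31 := nr _ (-1) r3 (lt0r_neq0 pm1).
have l1 : s1 < z by rewrite lt_neqAle n1z.
have l2 : z < s2 by rewrite lt_neqAle eq_sym n2z.
have l1' : 0 < s1 by rewrite lt_neqAle eq_sym n10.
have l2' : s2 < 1 by rewrite lt_neqAle n21.
have l3 : s3 < -1 by rewrite lt_neqAle n31.
exists s1, s2, s3; split=> //; split; rewrite ?pR //; try lra; nra.
Qed.

Lemma irreducible_3sqr : irreducible_poly (3 *: 'X^2 - 1 : {poly rat}).
Proof.
have s3 : size (3 *: 'X^2 - 1 : {poly rat}) = 3.
  by rewrite size_polyDl size_scale // size_polyXn // size_polyN size_poly1.
apply: cubic_irreducible; rewrite ?s3 // => x; apply/negP => /rootP.
rewrite hornerD hornerN hornerZ hornerXn hornerC => E.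
have E2 : 3 * (numq x) ^+ 2 = (denq x) ^+ 2.
  apply/eqP; rewrite -(eqr_int rat) rmorphM !rmorphXn /= numqE; apply/eqP.
  transitivity ((3 * x ^+ 2) * (denq x)%:~R ^+ 2 : rat); first by ring.
  by rewrite (subr0_eq E) mul1r.
have E3 : (3 * `|numq x| ^ 2 = `|denq x| ^ 2)%N.
  by rewrite -!abszX -E2 abszM.
(* The two sides have 3-adic valuations of opposite parity. *)
have := congr1 (logn 3) E3.
have [n0|n0] := eqVneq `|numq x|%N 0%N.
  move: E3; rewrite n0 muln0 => /esym/eqP; rewrite expn_eq0 absz_eq0.
  by rewrite (negPf (denq_neq0 x)).
rewrite lognM ?expn_gt0 ?lt0n ?n0 // !lognX (_ : logn 3 3 = 1%N) //; lia.
Qed.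

Lemma sgr_mul_sqr (R : realDomainType) (c x : R) :
  c * x ^+ 2 != 0 -> Num.sg (c * x ^+ 2) = Num.sg c.
Proof.
rewrite mulf_eq0 expf_eq0 /= negb_or => /andP[_ x0].
by rewrite sgrM sgrX sqr_sg x0 mulr1.
Qed.

Lemma dvdp_ramified (d : {poly rat}) :
  d %| (3 *: 'X^2 - 1) * ('X * ('X - 1) * ('X + 1)) ->
  exists (k : rat) (e a b c : bool), k != 0 /\
    d = k *: ((3 *: 'X^2 - 1) ^+ e * ('X ^+ a * ('X - 1) ^+ b * ('X + 1) ^+ c)).
Proof.
have iX (c : rat) : irreducible_poly ('X + c%:P) by apply: irreducible_XaddC.
have iX0 : irreducible_poly ('X : {poly rat}) by move: (iX 0); rewrite addr0.
have iX1 : irreducible_poly ('X + 1 : {poly rat}) by apply: iX.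
have iXm1 : irreducible_poly ('X - 1 : {poly rat}) by rewrite -polyCN; apply: iX.
move=> /(dvdp_irred_mul _ _ _ _ irreducible_3sqr)[e [d1 [-> d1d]]].
move: d1d; rewrite -mulrA => /(dvdp_irred_mul _ _ _ _ iX0)[a [d2 [-> d2d]]].
move: d2d => /(dvdp_irred_mul _ _ _ _ iXm1)[b [d3 [-> d3d]]].
have {d3d} : d3 %| ('X + 1) * 1 by rewrite mulr1.
move=> /(dvdp_irred_mul _ _ _ _ iX1)[c [d4 [-> d4d]]].
move: d4d; rewrite dvdp1 => /size_poly1P[k k0 ->].
exists k, e, a, b, c; split=> //; by rewrite -(mul_polyC k) [RHS]mulrC !mulrA.
Qed.

(** From s1 to s2 only 3s^2 - 1 changes sign, which forces e = 0; from s2 to s3 exactly s and s + 1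
    change sign, which forces i = l. The factor s - 1 is negative at all three points, so j stays
    free. *)
Lemma sgr_pattern (R : realFieldType) (s1 s2 s3 : R) (e i j l : bool) :
  let G s := (3 * s ^+ 2 - 1) ^+ e * (s ^+ i * (s - 1) ^+ j * (s + 1) ^+ l) in
  0 < s1 < 1 -> 3 * s1 ^+ 2 < 1 -> 0 < s2 < 1 -> 1 < 3 * s2 ^+ 2 -> s3 < -1 ->
  Num.sg (G s1) = Num.sg (G s2) -> Num.sg (G s2) = Num.sg (G s3) ->
  e = false /\ i = l.
Proof.
move=> G /andP[a1 b1] c1 /andP[a2 b2] c2 a3.
have sgs s : Num.sg (G s) = Num.sg (3 * s ^+ 2 - 1) ^+ e *
    (Num.sg s ^+ i * Num.sg (s - 1) ^+ j * Num.sg (s + 1) ^+ l).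
  by rewrite /G !sgrM !sgrX.
have p1 : Num.sg (3 * s1 ^+ 2 - 1) = -1 by rewrite ltr0_sg // subr_lt0.
have p2 : Num.sg (3 * s2 ^+ 2 - 1) = 1 by rewrite gtr0_sg // subr_gt0.
have p3 : Num.sg (3 * s3 ^+ 2 - 1) = 1 by rewrite gtr0_sg //; nra.
have q1 : Num.sg s1 = 1 by rewrite gtr0_sg.
have q2 : Num.sg s2 = 1 by rewrite gtr0_sg.
have q3 : Num.sg s3 = -1 by rewrite ltr0_sg //; lra.
have m1 : Num.sg (s1 - 1) = -1 by rewrite ltr0_sg //; lra.
have m2 : Num.sg (s2 - 1) = -1 by rewrite ltr0_sg //; lra.
have m3 : Num.sg (s3 - 1) = -1 by rewrite ltr0_sg //; lra.
have n1 : Num.sg (s1 + 1) = 1 by rewrite gtr0_sg //; lra.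
have n2 : Num.sg (s2 + 1) = 1 by rewrite gtr0_sg //; lra.
have n3 : Num.sg (s3 + 1) = -1 by rewrite ltr0_sg //; lra.
rewrite !sgs p1 p2 p3 q1 q2 q3 m1 m2 m3 n1 n2 n3 !expr1n !mul1r !mulr1.
by clear; case: e i j l => [] [] [] []; rewrite /= ?expr0 ?expr1 => h1 h2;
  first [by split|exfalso; lra].
Qed.

Lemma descent_class (R : rcfType) (w0 : rat) (A B S : {poly rat}) :
  0 < w0 -> 3 * w0 <= 1 -> coprimep A B -> B != 0 -> B.[w0] = 0 ->
  'X * B * (A ^+ 3 - A * B ^+ 2 + 'X * B ^+ 3) = S ^+ 2 ->
  exists c k g, [/\ c != 0, k \in [:: 1; wpoly; 'X - 1; 'X * ('X + 1)] &
    of_coords A (- B) 0 = c *: (k * g ^+ 2)].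
Proof.
move=> w00 w03 cAB B0 Bw0 E.
have X0 : ('X : {poly rat}) != 0 by rewrite polyX_eq0.
have wE : wpoly = - ('X * ('X - 1) * ('X + 1)) by rewrite /wpoly; ring.
pose f := of_coords A (- B) 0.
have fE : f = (A \Po wpoly) - 'X * (B \Po wpoly).
  by rewrite /f /of_coords comp_polyN comp_poly0; ring.
pose a := A \Po wpoly; pose b := B \Po wpoly.
have cab : coprimep a b by apply: coprimep_comp_poly.
have cfb : coprimep f b.
  apply/coprimepP => d df db; apply: (coprimepP _ _ cab) => //.
  have -> : a = f + 'X * b by rewrite fE subrK.
  by rewrite dvdp_add // dvdp_mull.
(* The cofactor of a - s b in a^3 - a b^2 + w b^3. *)
pose f2 := a ^+ 2 + 'X * a * b + ('X ^+ 2 - 1) * b ^+ 2.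
have f0 : f != 0.
  apply: contra_neq B0 => fz.
  have : of_coords A (- B) 0 = of_coords 0 0 0.
    by rewrite -/f fz /of_coords comp_poly0 !mulr0 !addr0.
  by case/of_coords_inj => _ /eqP; rewrite oppr_eq0 => /eqP.
have fS : f * (f2 * wpoly * b) = (S \Po wpoly) ^+ 2.
  rewrite -[RHS](rmorphXn (comp_poly wpoly)) -E /= !comp_polyE_ring -/a -/b fE -/a -/b.
  by rewrite /f2 /wpoly; ring.
have [c [g [c0 Ef]]] := mul_sqr_gcdp _ _ _ _ f0 fS.
have kd : gcdp f (f2 * wpoly * b) %| (3 *: 'X^2 - 1) * ('X * ('X - 1) * ('X + 1)).
  set k := gcdp _ _.
  have kf : k %| f by apply: dvdp_gcdl.
  have kb : coprimep k b := coprimep_dvdr kf cfb.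
  have : k %| f2 * wpoly * b by apply: dvdp_gcdr.
  rewrite Gauss_dvdpl // => kf2.
  (* Modulo f, that is for a = s b, the cofactor [f2] becomes (3s^2 - 1) b^2, and b is coprime to
     f. *)
  have : k %| (3 *: 'X^2 - 1) * wpoly * b ^+ 2.
    rewrite (_ : _ * _ * _ = f2 * wpoly - f * ((a + 2 * 'X * b) * wpoly)).
      by rewrite dvdp_sub // dvdp_mulr.
    by rewrite fE -/a -/b /f2 -mul_polyC -[3%:P]/(3%:R%:P) polyC_natr; ring.
  by rewrite Gauss_dvdpl ?coprimep_expr // wE mulrN dvdpNr.
have [k [e [i [j [l [k0 Ek]]]]]] := dvdp_ramified _ kd.
rewrite Ek -scalerAl scalerA in Ef.
have ck0 : c * k != 0 by rewrite mulf_neq0.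
move: (c * k) ck0 Ef => {c k c0 k0 kd Ek} c c0 Ef.
have A0 := coprimep_no_common_root _ _ _ _ cAB Bw0.
have ww0 : 0 < (ratr w0 : R) by rewrite ltr0q.
have ww3 : 3 * (ratr w0 : R) <= 1.
  have : ratr (3 * w0) <= ratr 1 :> R by rewrite ler_rat.
  by rewrite rmorphM /= ratr_nat rmorph1.
have [s1 [s2 [s3 [[r1 r2 r3] [a1 c1] [a2 c2] a3]]]] := real_fiber _ _ ww0 ww3.
pose G (s : R) := (3 * s ^+ 2 - 1) ^+ e * (s ^+ i * (s - 1) ^+ j * (s + 1) ^+ l).
have ME s : (map_poly (ratr : rat -> R)
    ((3 *: 'X^2 - 1) ^+ e * ('X ^+ i * ('X - 1) ^+ j * ('X + 1) ^+ l))).[s] = G s.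
  rewrite !rmorphM !rmorphXn !rmorphB rmorphD /= map_polyZ rmorphXn rmorph1 !map_polyX /=.
  rewrite (_ : ratr 3 = 3 :> R); last exact: ratr_nat.
  by rewrite !hornerM !horner_exp !hornerD hornerZ horner_exp map_polyX hornerX !hornerN !hornerC.
(* At every real point over w0 the term s B vanishes, so f takes the common value A(w0). *)
have Mf s : s - s ^+ 3 = ratr w0 -> (map_poly (ratr : rat -> R) f).[s] = ratr A.[w0].
  move=> rs; have hw : (map_poly (ratr : rat -> R) wpoly).[s] = ratr w0.
    by rewrite /wpoly rmorphB rmorphXn /= map_polyX hornerD hornerN hornerX hornerXn.
  rewrite fE rmorphB rmorphM /= !map_comp_poly.
  rewrite hornerD hornerN hornerM !horner_comp hw.
  by rewrite !horner_map Bw0 rmorph0 mulr0 subr0.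
have fs s : s - s ^+ 3 = ratr w0 -> Num.sg (ratr c * G s) = Num.sg (ratr A.[w0]).
  move=> rs; have Es : ratr A.[w0] = ratr c * G s * (map_poly (ratr : rat -> R) g).[s] ^+ 2.
    rewrite -(Mf s rs) Ef map_polyZ rmorphM rmorphXn hornerZ hornerM horner_exp mulrA.
    by rewrite ME.
  by rewrite Es sgr_mul_sqr // -Es fmorph_eq0.
have [g1 g2 g3] := And3 (fs _ r1) (fs _ r2) (fs _ r3).
have nz : ratr A.[w0] != 0 :> R by rewrite fmorph_eq0.
have nc : ratr c != 0 :> R by rewrite fmorph_eq0.
have g12 : Num.sg (G s1) = Num.sg (G s2).
  by apply: (mulfI (x := Num.sg (ratr c))); rewrite ?sgr_eq0 // -!sgrM g1 g2.
have g23 : Num.sg (G s2) = Num.sg (G s3).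
  by apply: (mulfI (x := Num.sg (ratr c))); rewrite ?sgr_eq0 // -!sgrM g2 g3.
have [e0 il] := sgr_pattern _ _ _ _ _ _ _ _ a1 c1 a2 c2 a3 g12 g23.
move: Ef; rewrite e0 -il expr0 mul1r => {}Ef.
(* For i = j = 1 the product s(s - 1)(s + 1) is -w, and the sign moves into the constant. *)
case: (i) (j) Ef => [] [] Ef.
- exists (- c), wpoly, g; rewrite oppr_eq0; split=> //; first by rewrite !inE eqxx !orbT.
  by rewrite -/f Ef !expr1 wE mulNr scalerN scaleNr opprK.
- exists c, ('X * ('X + 1)), g; split=> //; first by rewrite !inE eqxx !orbT.
  by rewrite -/f Ef expr0 !expr1 mulr1.
- exists c, ('X - 1), g; split=> //; first by rewrite !inE eqxx !orbT.
  by rewrite -/f Ef !expr0 !expr1 mul1r mulr1.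
- exists c, 1, g; split=> //; first by rewrite !inE eqxx.
  by rewrite -/f Ef !expr0 !mulr1.
Qed.

(** * Halving (t0, t0) *)

(** The root, seen in [algC], is a rational algebraic integer, hence an integer. *)
Lemma monic_int_root (p : {poly int}) (x : rat) :
  p \is monic -> root (map_poly intr p) x -> exists k : int, x = k%:~R.
Proof.
move=> mp rx; have xA : ratr x \in Aint.
  apply: (@root_monic_Aint (map_poly intr p)).
  - rewrite (_ : map_poly intr p = map_poly ratr (map_poly (intr : int -> rat) p)).
      by rewrite fmorph_root.
    by rewrite -map_poly_comp; apply: eq_map_poly => y /=; rewrite ratr_int.
  - by rewrite monic_map.
  - by apply/polyOverP => i; rewrite coef_map /= intr_int.
have /intrP[k Ek] := Cint_rat_Aint (Crat_rat x) xA.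
by exists k; apply: (fmorph_inj (ratr : {rmorphism rat -> algC})); rewrite /= ratr_int.
Qed.

(** E_t0 has no rational 2-torsion. A root is an integer k with k^3 = t0^2 (k - 1), so k - 1 divides
    1 and k is 0 or 2; then t0^2 would be 0 or 8. *)
Lemma cubic_no_root (t0 : nat) (x : rat) : (2 < t0)%N ->
  x ^+ 3 - t0%:R ^+ 2 * x + t0%:R ^+ 2 != 0.
Proof.
move=> t2; apply/eqP => E.
have [k Ek] : exists k : int, x = k%:~R.
  pose p : {poly int} := 'X^3 + (- ((t0%:R ^+ 2) *: 'X) + (t0%:R ^+ 2)%:P).
  apply: (@monic_int_root p).
    rewrite monicE lead_coefDl ?lead_coefXn // size_polyXn.
    rewrite (leq_ltn_trans (size_polyD _ _)) // gtn_max size_polyN.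
    by rewrite (leq_ltn_trans (size_scale_leq _ _)) ?size_polyX //=
      (leq_ltn_trans (size_polyC_leq1 _)).
  rewrite rootE /p !rmorphD rmorphN /= map_polyXn map_polyZ map_polyX map_polyC /=.
  rewrite !hornerD hornerN hornerZ hornerX hornerXn hornerC !rmorphXn /= !rmorph_nat.
  by rewrite addrA E.
move: E; rewrite Ek => E.
have {}E : k ^+ 3 = t0%:Z ^+ 2 * (k - 1).
  apply: (@intr_inj rat); rewrite rmorphXn rmorphM rmorphXn rmorphB rmorph1 /=.
  by apply: subr0_eq; rewrite -E -!pmulrn; ring.
have d : (k - 1 %| 1)%Z.
  by apply/dvdzP; exists (t0%:Z ^+ 2 - (k ^+ 2 + k + 1)); rewrite mulrBl -E; ring.
have : `|k - 1|%N = 1%N by apply/eqP; rewrite -dvdn1 -[1%N]/`|1%Z|%N.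
move=> h; have [k2|k0] : k = 2 \/ k = 0 by lia.
- by move: E; rewrite k2; nia.
- by move: E; rewrite k0; nia.
Qed.

(* The norm of a + b s + c s^2, where s^3 = s - w. *)
Definition norm3 {R : pzRingType} (w a b c : R) : R :=
  a ^+ 3 - w * b ^+ 3 + w ^+ 2 * c ^+ 3 + 2 * a ^+ 2 * c - a * b ^+ 2 + a * c ^+ 2
  + w * b * c ^+ 2 + 3 * w * a * b * c.

Lemma norm3_sqr (R : comPzRingType) (w a b c : R) :
  norm3 w (a ^+ 2 - 2 * b * c * w) (2 * a * b + 2 * b * c - c ^+ 2 * w)
    (b ^+ 2 + 2 * a * c + c ^+ 2) = norm3 w a b c ^+ 2.
Proof. by rewrite /norm3; ring. Qed.

(* Over Q, c w (1 - s) is the square of h0 + h1 s + h2 s^2, with w = 1/t and s^3 = s - w;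
   then m = - t (h0 + h1 + h2) / h2. *)
Lemma halving_quartic (t h0 h1 h2 c : rat) : t != 0 -> c != 0 ->
  h0 ^+ 2 - 2 * h1 * h2 * t^-1 = c * t^-1 ->
  2 * h0 * h1 + 2 * h1 * h2 - h2 ^+ 2 * t^-1 = - (c * t^-1) ->
  h1 ^+ 2 + 2 * h0 * h2 + h2 ^+ 2 = 0 ->
  exists m : rat, m ^+ 4 - 6 * t * m ^+ 2 - 8 * t * m + t ^+ 2 = 0.
Proof.
move=> t0 c0 e0 e1 e2; pose w := t^-1.
have w0 : w != 0 by rewrite invr_eq0.
have h20 : h2 != 0.
  apply/eqP => h2z; move: e2 e1; rewrite h2z => e2.
  have -> : h1 = 0 by apply/eqP; rewrite -sqrf_eq0 -e2; apply/eqP; ring.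
  move/eqP; rewrite -subr_eq0 => /eqP E; move: (mulf_neq0 c0 w0).
  by rewrite -/w in E; rewrite -{}E; apply/negP; rewrite negbK; apply/eqP; ring.
exists (- t * (h0 + h1 + h2) / h2).
pose x := h1 / h2; have E1 : h1 = x * h2 by rewrite /x divfK.
have E0 : h0 = - (x ^+ 2 + 1) / 2 * h2.
  apply: (mulIf h20); move: e2; rewrite E1 => e2; lra.
have q0 : h2 ^+ 2 != 0 by rewrite expf_neq0.
(* The sum of the first two equations eliminates c; the third has already given h0/h2 in terms of
   x. *)
have key : (x ^+ 2 - 2 * x - 1) ^+ 2 = (8 * x + 4) * w.
  apply: (mulIf q0); move: e0 e1; rewrite -/w E0 E1 => e0 e1; lra.
have -> : - t * (h0 + h1 + h2) / h2 = t * (x ^+ 2 - 2 * x - 1) / 2.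
  by rewrite E0 E1; field.
have {}key : (t * (x ^+ 2 - 2 * x - 1)) ^+ 2 = (8 * x + 4) * t.
  by rewrite exprMn key /w; field.
set y := t * _ in key *.
(* Here y = 2m. Solving y^2 = (8x + 4)t for x t and inserting it in the definition of y eliminates
   x. *)
have xt : x * t = (y ^+ 2 / 4 - t) / 2 by lra.
have : t * y = (x * t) ^+ 2 - 2 * (x * t) * t - t ^+ 2 by rewrite /y; ring.
rewrite xt => yt.
transitivity (4 * ((y ^+ 2 / 4 - t) / 2) ^+ 2 - 8 * ((y ^+ 2 / 4 - t) / 2) * t
  - 4 * t ^+ 2 - 4 * (t * y)); first by field.
by rewrite yt; field.
Qed.

(** The root m of the monic quartic is an integer n. Completing the square in t gives (t - 3n^2 -
    4n)^2 = 8 n^2 (n + 1)(n + 2), so 8(n + 1)(n + 2) is a square (2k)^2, which is Pell's equation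
    for 2n + 3 and k. *)
Lemma quartic_pell (t : int) (m : rat) : t != 0 ->
  m ^+ 4 - 6 * t%:~R * m ^+ 2 - 8 * t%:~R * m + t%:~R ^+ 2 = 0 ->
  exists N k m : int, [/\ N = 2 * m + 3, N ^+ 2 - 2 * k ^+ 2 = 1 &
    t = m * (3 * m + 4 + 2 * k)].
Proof.
move=> t0 E.
have [n En] : exists n : int, m = n%:~R.
  pose p : {poly int} := 'X^4 + (- ((6 * t) *: 'X^2) - (8 * t) *: 'X + (t ^+ 2)%:P).
  apply: (@monic_int_root p).
    have s2 : (size (- ((6 * t) *: 'X^2) : {poly int}) <= 3)%N.
      by rewrite size_polyN (leq_trans (size_scale_leq _ _)) ?size_polyXn.
    have s1 : (size (- ((8 * t) *: 'X) : {poly int}) <= 3)%N.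
      by rewrite size_polyN (leq_trans (size_scale_leq _ _)) ?size_polyX.
    rewrite monicE lead_coefDl ?lead_coefXn // size_polyXn ltnS.
    rewrite (leq_trans (size_polyD _ _)) // geq_max.
    rewrite (leq_trans (size_polyD _ _)) ?geq_max ?(leq_trans s2) ?(leq_trans s1) //.
    by rewrite (leq_trans (size_polyC_leq1 _)).
  rewrite rootE /p !rmorphD !rmorphN /= !map_polyZ !map_polyXn map_polyX map_polyC /=.
  rewrite !hornerD !hornerN !hornerZ hornerX !hornerXn hornerC !rmorphM /=.
  by apply/eqP; rewrite -[RHS]E; ring.
have {}E : (t - (3 * n ^+ 2 + 4 * n)) ^+ 2 = n ^+ 2 * (8 * (n + 1) * (n + 2)).
  apply: (@intr_inj rat); apply: subr0_eq; rewrite -[RHS]E En.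
  by rewrite !(rmorphXn, rmorphB, rmorphM, rmorphD) /=; ring.
have n0 : n != 0.
  apply: contra_neq t0 => n0; apply/eqP; rewrite -sqrf_eq0; apply/eqP.
  rewrite n0 in E; transitivity ((t - (3 * 0 ^+ 2 + 4 * 0)) ^+ 2); first by ring.
  by rewrite E; ring.
have : (n ^+ 2 %| (t - (3 * n ^+ 2 + 4 * n)) ^+ 2)%Z by rewrite E dvdz_mulr.
rewrite dvdz_pexp2r // => /dvdzP[c Ec].
have {}E : c ^+ 2 = 8 * (n + 1) * (n + 2).
  apply: (mulfI (expf_neq0 2 n0)); rewrite -E Ec; ring.
have : (2 ^+ 2 %| c ^+ 2)%Z.
  by apply/dvdzP; exists (2 * (n + 1) * (n + 2)); rewrite E; ring.
rewrite dvdz_pexp2r // => /dvdzP[k Ek].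
exists (2 * n + 3), k, n; split=> //.
  by move: E; rewrite Ek => E; lia.
by apply: (subIr (3 * n ^+ 2 + 4 * n)); rewrite Ec Ek; ring.
Qed.

(** * Units of Z[sqrt 2] and the four forms *)

Lemma s2_sqr : s2 ^+ 2 = 2.
Proof. exact: sqrtCK. Qed.

Lemma s2_neq0 : s2 != 0.
Proof. by rewrite sqrtC_eq0 pnatr_eq0. Qed.

(** Irrationality of sqrt 2: (a - c)^2 = 2(b - d)^2 has 2-adic valuations of opposite parity unless
    both sides vanish. *)
Lemma s2_coords_inj (a b c d : int) :
  a%:~R + b%:~R * s2 = c%:~R + d%:~R * s2 -> a = c /\ b = d.
Proof.
move=> E; have E2 : (a - c) ^+ 2 = 2 * (b - d) ^+ 2.
  apply: (@intr_inj algC).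
  have E1 : (a - c)%:~R = (d - b)%:~R * s2.
    by apply: subr0_eq; rewrite -(subrr (c%:~R + d%:~R * s2)) -{1}E !rmorphB /=; ring.
  by rewrite rmorphXn /= E1 exprMn s2_sqr rmorphM rmorphXn !rmorphB /=; ring.
have {}E2 : (`|a - c| ^ 2 = 2 * `|b - d| ^ 2)%N by rewrite -!abszX E2 abszM.
have [bd|bd] := eqVneq `|b - d|%N 0%N.
  by move: E2; rewrite bd muln0 => /eqP; rewrite expn_eq0 => /eqP; lia.
have [ac|ac] := eqVneq `|a - c|%N 0%N.
  by move: E2; rewrite ac => /esym/eqP; rewrite muln_eq0 expn_eq0 (negPf bd).
have := congr1 (logn 2) E2.
rewrite lognM ?expn_gt0 ?lt0n ?bd // !lognX (_ : logn 2 2 = 1%N) //; lia.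
Qed.

Lemma eps_neq0 : 1 + s2 != 0.
Proof.
apply/eqP => E; have [|] := s2_coords_inj 1 1 0 0 => //.
by rewrite !rmorph1 rmorph0 mul1r mul0r addr0.
Qed.

Lemma eps_conj_neq0 : 1 - s2 != 0.
Proof.
apply/eqP => E; have [|] := s2_coords_inj 1 (-1) 0 0 => //.
by rewrite rmorphN !rmorph1 rmorph0 mulN1r mul0r addr0.
Qed.

Lemma a_pD m n : a_p (m + n) = a_p m * a_p n.
Proof. by rewrite /a_p expfzDr // eps_neq0. Qed.

Lemma a_mD m n : a_m (m + n) = a_m m * a_m n.
Proof. by rewrite /a_m expfzDr // eps_conj_neq0. Qed.

Lemma a_p_N1 : a_p (-1) = s2 - 1.
Proof.
rewrite /a_p exprN1; apply: (mulfI eps_neq0); rewrite divff ?eps_neq0 //.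
by transitivity (s2 ^+ 2 - 1); [rewrite s2_sqr|]; ring.
Qed.

Lemma a_m_N1 : a_m (-1) = - s2 - 1.
Proof.
rewrite /a_m exprN1; apply: (mulfI eps_conj_neq0); rewrite divff ?eps_conj_neq0 //.
by transitivity (s2 ^+ 2 - 1); [rewrite s2_sqr|]; ring.
Qed.

(** The conjugate power is recorded as well because the four forms combine both powers. *)
Definition s2_coords (n a b : int) : Prop :=
  a_p n = a%:~R + b%:~R * s2 /\ a_m n = a%:~R - b%:~R * s2.

(* Multiplication by 1 + sqrt 2 and by its inverse sqrt 2 - 1. *)
Lemma s2_coordsS n a b : s2_coords n a b -> s2_coords (n + 1) (a + 2 * b) (a + b).
Proof.
case=> Ep Em; split; rewrite ?a_pD ?a_mD ?Ep ?Em /a_p /a_m expr1z !rmorphD rmorphM /=.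
  by transitivity (a%:~R + b%:~R * s2 ^+ 2 + (a%:~R + b%:~R) * s2); [|rewrite s2_sqr]; ring.
by transitivity (a%:~R + b%:~R * s2 ^+ 2 - (a%:~R + b%:~R) * s2); [|rewrite s2_sqr]; ring.
Qed.

Lemma s2_coordsP n a b : s2_coords n a b -> s2_coords (n - 1) (2 * b - a) (a - b).
Proof.
case=> Ep Em; split; rewrite ?a_pD ?a_mD ?Ep ?Em ?a_p_N1 ?a_m_N1 !rmorphB rmorphM /=.
  by transitivity (b%:~R * s2 ^+ 2 - a%:~R + (a%:~R - b%:~R) * s2); [|rewrite s2_sqr]; ring.
by transitivity (b%:~R * s2 ^+ 2 - a%:~R - (a%:~R - b%:~R) * s2); [|rewrite s2_sqr]; ring.
Qed.

Lemma s2_coords0 : s2_coords 0 1 0.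
Proof. by split; rewrite /a_p /a_m expr0z rmorph1 mul0r ?subr0 ?addr0. Qed.

(** The norm of (1 + sqrt 2)^n is (-1)^n; the parity of n later separates forms 1 and 4 from forms 2
    and 3. *)
Lemma s2_coords_ex n : exists a b, s2_coords n a b /\
  ((exists m, n = 2 * m /\ a ^+ 2 - 2 * b ^+ 2 = 1) \/
   (exists m, n = 2 * m + 1 /\ a ^+ 2 - 2 * b ^+ 2 = -1)).
Proof.
elim: n => [|n [a [b [H E]]]|n [a [b [H E]]]].
- by exists 1, 0; split; [exact: s2_coords0|left; exists 0].
- exists (a + 2 * b), (a + b); rewrite -addn1 PoszD; split; first exact: s2_coordsS.
  by case: E => [[m [-> E]]|[m [-> E]]]; [right; exists m|left; exists (m + 1)]; split; lia.
- exists (2 * b - a), (a - b); rewrite -addn1 PoszD opprD; split; first exact: s2_coordsP.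
  by case: E => [[m [-> E]]|[m [-> E]]]; [right; exists (m - 1)|left; exists m]; split; lia.
Qed.

Lemma s2_coords_parity n a b : s2_coords n a b ->
  (exists m, n = 2 * m /\ a ^+ 2 - 2 * b ^+ 2 = 1) \/
  (exists m, n = 2 * m + 1 /\ a ^+ 2 - 2 * b ^+ 2 = -1).
Proof.
have [a' [b' [[H _] E]]] := s2_coords_ex n; case=> H' _.
by have [<- <-] : a' = a /\ b' = b by apply: s2_coords_inj; rewrite -H -H'.
Qed.

(** Descent on |b|: if a b > 0, dividing by 1 + sqrt 2 shrinks |b|; if a b < 0, multiplying does. At
    b = 0 the unit is 1 or -1. *)
Lemma pell (a b : int) : a ^+ 2 - 2 * b ^+ 2 = 1 \/ a ^+ 2 - 2 * b ^+ 2 = -1 ->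
  exists n, s2_coords n a b \/ s2_coords n (- a) (- b).
Proof.
have [k] := ubnP `|b|%N; elim: k a b => // k IHk a b; rewrite ltnS => bk Hab.
have [b0|b0] := eqVneq b 0.
  exists 0; have [->|->] : a = 1 \/ a = -1 by move: Hab; rewrite b0; nia.
    by left; rewrite b0; apply: s2_coords0.
  by right; rewrite b0; apply: s2_coords0.
have a0 : a != 0 by apply/eqP => a0; move: Hab; rewrite a0; nia.
have [ab|ab] : 0 < a * b \/ a * b < 0 by nia.
- have [||n Hn] := IHk (2 * b - a) (a - b); first by nia.
    by case: Hab => E; [right|left]; lia.
  exists (n + 1); case: Hn => /s2_coordsS H; [left|right]; move: H.
    by congr (s2_coords _ _ _); ring.
  by congr (s2_coords _ _ _); ring.
- have [||n Hn] := IHk (a + 2 * b) (a + b); first by nia.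
    by case: Hab => E; [right|left]; lia.
  exists (n - 1); case: Hn => /s2_coordsP H; [left|right]; move: H.
    by congr (s2_coords _ _ _); ring.
  by congr (s2_coords _ _ _); ring.
Qed.

Lemma s2_coords_uniq n a b c d : s2_coords n a b -> s2_coords n c d -> a = c /\ b = d.
Proof. by case=> H _ [H' _]; apply: s2_coords_inj; rewrite -H -H'. Qed.

Lemma s2_coordsD m n a b c d : s2_coords m a b -> s2_coords n c d ->
  s2_coords (m + n) (a * c + 2 * (b * d)) (a * d + b * c).
Proof.
case=> Ep Em [Ep' Em']; split; rewrite ?a_pD ?a_mD ?Ep ?Em ?Ep' ?Em' !rmorphD !rmorphM /=;
  rewrite -[2%:~R]/(2 : algC) -s2_sqr; ring.
Qed.

(** The inverse of a unit is its conjugate times its norm, the norm being 1 or -1. *)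
Lemma s2_coordsN n a b : s2_coords n a b ->
  s2_coords (- n) ((a ^+ 2 - 2 * b ^+ 2) * a) (- ((a ^+ 2 - 2 * b ^+ 2) * b)).
Proof.
move=> H; set e := a ^+ 2 - 2 * b ^+ 2.
have [c [d [Hc _]]] := s2_coords_ex (- n).
have := s2_coordsD _ _ _ _ _ _ Hc H; rewrite addNr.
case/(s2_coords_uniq _ _ _ _ _ s2_coords0) => E1 E2.
have ee : e ^+ 2 = 1 by rewrite /e; case: (s2_coords_parity _ _ _ H) => [[m [_ ->]]|[m [_ ->]]].
have Ec : c = e * a.
  transitivity (e ^+ 2 * c); first by rewrite ee mul1r.
  transitivity (e * (a * (c * a + 2 * (d * b)) - 2 * b * (c * b + d * a)));
    first by rewrite /e; ring.
  by rewrite -E1 -E2; ring.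
have Ed : d = - (e * b).
  transitivity (e ^+ 2 * d); first by rewrite ee mul1r.
  transitivity (e * (a * (c * b + d * a) - b * (c * a + 2 * (d * b))));
    first by rewrite /e; ring.
  by rewrite -E1 -E2; ring.
by rewrite -Ec -Ed.
Qed.

(** In the coordinates of the unit, forms 1 and 2 become one polynomial, at even and odd exponents
    respectively; so do forms 4 and 3. *)
Lemma form1E m a b : s2_coords (2 * m) a b -> form1 m = (4 * b ^+ 3 * (2 * a + 3 * b))%:~R.
Proof.
case=> Ep Em; rewrite /form1 /fuv Ep Em !(rmorphM, rmorphD) /=.
by field; rewrite s2_neq0.
Qed.

Lemma form2E m a b : s2_coords (2 * m + 1) a b -> form2 m = (4 * b ^+ 3 * (2 * a + 3 * b))%:~R.
Proof.
case=> Ep Em; rewrite /form2 /fuv Ep Em !(rmorphM, rmorphD) /=.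
by field; rewrite s2_neq0.
Qed.

Lemma form3E m a b : s2_coords (2 * m + 1) a b -> form3 m = (a ^+ 3 * (3 * a + 4 * b))%:~R.
Proof.
case=> Ep Em; rewrite /form3 /fuv Ep Em !(rmorphM, rmorphD) /=.
rewrite (_ : s2 * _ = 2 * b%:~R * s2 ^+ 2); last by ring.
by rewrite s2_sqr; field.
Qed.

Lemma form4E m a b : s2_coords (2 * m) a b -> form4 m = (a ^+ 3 * (3 * a + 4 * b))%:~R.
Proof.
case=> Ep Em; rewrite /form4 /fuv Ep Em !(rmorphM, rmorphD) /=.
rewrite (_ : s2 * _ = 2 * b%:~R * s2 ^+ 2); last by ring.
by rewrite s2_sqr; field.
Qed.

Definition is_form (x : algC) : Prop :=
  exists n : int, x = form1 n \/ x = form2 n \/ x = form3 n \/ x = form4 n.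

Lemma is_form_int (t : int) : is_form t%:~R ->
  exists a b : int, (a ^+ 2 - 2 * b ^+ 2 = 1 \/ a ^+ 2 - 2 * b ^+ 2 = -1) /\
   (t = 4 * b ^+ 3 * (2 * a + 3 * b) \/ t = a ^+ 3 * (3 * a + 4 * b)).
Proof.
have nrm n a b : s2_coords n a b -> a ^+ 2 - 2 * b ^+ 2 = 1 \/ a ^+ 2 - 2 * b ^+ 2 = -1.
  by case/s2_coords_parity => [[_ [_ ->]]|[_ [_ ->]]]; [left|right].
case=> n; have [a [b [H _]]] := s2_coords_ex (2 * n).
have [c [d [H' _]]] := s2_coords_ex (2 * n + 1).
rewrite (form1E _ _ _ H) (form4E _ _ _ H) (form2E _ _ _ H') (form3E _ _ _ H').
case=> [|[|[|]]] /intr_inj E.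
- by exists a, b; split; [exact: nrm H|left].
- by exists c, d; split; [exact: nrm H'|left].
- by exists c, d; split; [exact: nrm H'|right].
- by exists a, b; split; [exact: nrm H|right].
Qed.

(* If (2m + 3) + k sqrt 2 = +- (1 + sqrt 2)^(2j), then the forms are reached at the unit
   a + b sqrt 2 = (1 + sqrt 2)^(- j - 1), through
   (3 + 2 sqrt 2) ((2m + 3) + k sqrt 2) = +- (a - b sqrt 2)^2. *)
Lemma pell_is_form (m k : int) : (2 * m + 3) ^+ 2 - 2 * k ^+ 2 = 1 ->
  is_form (m * (3 * m + 4 + 2 * k))%:~R.
Proof.
move=> E; have [l Hl] := pell _ _ (or_introl E).
have [s [ss {}Hl]] : exists s : int, (s = 1 \/ s = -1) /\ s2_coords l (s * (2 * m + 3)) (s * k).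
  by case: Hl => Hl; [exists 1|exists (-1)]; rewrite ?mul1r ?mulN1r; split=> //; [left|right].
have [j Ej] : exists j, l = 2 * j.
  case: (s2_coords_parity _ _ _ Hl) => [[j [-> _]]|[j [_]]]; first by exists j.
  by case: ss => ->; rewrite ?mul1r ?mulN1r ?sqrrN E.
pose n := - (j + 1).
have [a [b [Hn _]]] := s2_coords_ex n.
have e1 := s2_coords_parity _ _ _ Hn.
have Hl2 := s2_coordsS _ _ _ (s2_coordsS _ _ _ Hl).
have Hm := s2_coordsN _ _ _ Hn.
have := s2_coordsD _ _ _ _ _ _ Hm Hm.
have -> : - n + - n = l + 1 + 1 by rewrite Ej /n; ring.
case/(s2_coords_uniq _ _ _ _ _ Hl2) => E1 E2.
have eo : (a ^+ 2 - 2 * b ^+ 2) ^+ 2 = 1.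
  by case: e1 => [[_ [_ ->]]|[_ [_ ->]]].
have {}E1 : s * (3 * (2 * m + 3) + 4 * k) = a ^+ 2 + 2 * b ^+ 2.
  transitivity ((a ^+ 2 - 2 * b ^+ 2) ^+ 2 * (a ^+ 2 + 2 * b ^+ 2)); last by rewrite eo mul1r.
  move: E1; set e := a ^+ 2 - _ => E1.
  transitivity (s * (2 * m + 3) + 2 * (s * k) + 2 * (s * (2 * m + 3) + s * k)); first by ring.
  by rewrite E1; ring.
have {}E2 : s * (2 * (2 * m + 3) + 3 * k) = - 2 * a * b.
  transitivity ((a ^+ 2 - 2 * b ^+ 2) ^+ 2 * (- 2 * a * b)); last by rewrite eo mul1r.
  move: E2; set e := a ^+ 2 - _ => E2.
  transitivity (s * (2 * m + 3) + 2 * (s * k) + (s * (2 * m + 3) + s * k)); first by ring.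
  by rewrite E2; ring.
have sE x y : s * x = y -> x = s * y by case: ss => -> ; lia.
have F1 := sE _ _ E1; have F2 := sE _ _ E2.
(* Dividing by 3 + 2 sqrt 2 recovers 2m + 3 and k from a and b. *)
have m2 : 2 * m = s * (3 * a ^+ 2 + 6 * b ^+ 2 + 8 * a * b) - 3 by case: ss F1 F2 => ->; lia.
have c2 : 2 * (3 * m + 4 + 2 * k) = s * (a ^+ 2 + 2 * b ^+ 2) - 1 by lia.
have t4 : 4 * (m * (3 * m + 4 + 2 * k)) =
    (s * (3 * a ^+ 2 + 6 * b ^+ 2 + 8 * a * b) - 3) * (s * (a ^+ 2 + 2 * b ^+ 2) - 1).
  by rewrite -m2 -c2; ring.
have n4 : (4 : int) != 0 by [].
pose Q1 := 3 * a ^+ 2 + 6 * b ^+ 2 + 8 * a * b; pose Q2 := a ^+ 2 + 2 * b ^+ 2.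
pose e := a ^+ 2 - 2 * b ^+ 2.
(* The signs of the norm e and of s select the form. Writing the constants 3 and 1 through e makes
   both factors of [t4] quadratic forms, with Q2 - e = 4b^2 and Q2 + e = 2a^2. *)
case: e1 => [[j' [nE eE]]|[j' [nE eE]]]; exists j'; rewrite nE in Hn.
- case: ss => sE1; rewrite sE1 in t4.
  + left; rewrite (form1E _ _ _ Hn); congr (_%:~R); apply: (mulfI n4); rewrite t4.
    by transitivity ((Q1 - 3 * e) * (Q2 - e)); [rewrite /e eE|rewrite /e];
      rewrite /Q1 /Q2; ring.
  + do 3! right; rewrite (form4E _ _ _ Hn); congr (_%:~R); apply: (mulfI n4); rewrite t4.
    by transitivity ((- Q1 - 3 * e) * (- Q2 - e)); [rewrite /e eE|rewrite /e];
      rewrite /Q1 /Q2; ring.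
- case: ss => sE1; rewrite sE1 in t4.
  + do 2! right; left; rewrite (form3E _ _ _ Hn); congr (_%:~R); apply: (mulfI n4); rewrite t4.
    by transitivity ((Q1 + 3 * e) * (Q2 + e)); [rewrite /e eE|rewrite /e];
      rewrite /Q1 /Q2; ring.
  + right; left; rewrite (form2E _ _ _ Hn); congr (_%:~R); apply: (mulfI n4); rewrite t4.
    by transitivity ((- Q1 + 3 * e) * (- Q2 + e)); [rewrite /e eE|rewrite /e];
      rewrite /Q1 /Q2; ring.
Qed.

(** * The descent *)

Lemma halving_is_form (t0 : nat) (h0 h1 h2 c : rat) : (0 < t0)%N -> c != 0 ->
  let w := t0%:R^-1 in
  h0 ^+ 2 - 2 * h1 * h2 * w = c * w ->
  2 * h0 * h1 + 2 * h1 * h2 - h2 ^+ 2 * w = - (c * w) ->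
  h1 ^+ 2 + 2 * h0 * h2 + h2 ^+ 2 = 0 -> is_form t0%:R.
Proof.
move=> t0_gt0 c0 w e0 e1 e2; have tn0 : t0%:R != 0 :> rat by rewrite pnatr_eq0 -lt0n.
have [m] := halving_quartic _ _ _ _ _ tn0 c0 e0 e1 e2.
rewrite pmulrn => E; have tz : t0%:Z != 0 by rewrite -lt0n in t0_gt0 *; lia.
have [N [k [n [-> Ek Et]]]] := quartic_pell _ _ tz E.
by rewrite pmulrn Et; apply: pell_is_form.
Qed.

(** In the left-hand element p1 and p2 stand one power of s lower than their multiples g1 and g2 on
    the right; this makes the drop strict. *)
Lemma size_descent p1 p2 g0 g1 g2 d :
  g1 = p1 * d -> g2 = p2 * d -> d != 0 -> of_coords g0 g1 g2 != 0 ->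
  (size (of_coords p1 (- p2) 0) < size (of_coords g0 g1 g2))%N.
Proof.
move=> E1 E2 d0 g0n; rewrite size_of_coords.
have gp : (0 < size (of_coords g0 g1 g2))%N by rewrite lt0n size_poly_eq0.
have Sle := size_of_coords g0 g1 g2.
have S1 : (size ('X * (g1 \Po wpoly))%R <= size (of_coords g0 g1 g2))%N.
  by rewrite Sle !leq_max leqnn orbT.
have S2 : (size ('X^2 * (g2 \Po wpoly))%R <= size (of_coords g0 g1 g2))%N.
  by rewrite Sle !leq_max leqnn orbT.
have cmp0 (p : {poly rat}) : p != 0 -> p \Po wpoly != 0.
  by move=> p0; rewrite comp_poly_eq0 ?size_wpoly.
have lec p : p != 0 -> (size (p \Po wpoly) <= size ((p * d)%R \Po wpoly))%N.
  move=> p0; apply: dvdp_leq; first by rewrite cmp0 // mulf_neq0.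
  by rewrite comp_polyM dvdp_mulr.
rewrite comp_poly0 mulr0 size_poly0 maxn0 gtn_max; apply/andP; split.
  have [->|p0] := eqVneq p1 0; first by rewrite comp_poly0 size_poly0.
  apply: leq_trans S1; rewrite mulrC size_mulX ?ltnS ?E1 ?lec //.
  by rewrite cmp0 // mulf_neq0.
have [->|p0] := eqVneq p2 0; first by rewrite oppr0 comp_poly0 mulr0 size_poly0.
apply: leq_trans S2; rewrite comp_polyN mulrN size_polyN expr2 -mulrA.
have szX (p : {poly rat}) : p != 0 -> size ('X * p) = (size p).+1.
  by move=> n0; rewrite mulrC size_mulX.
have n1 := cmp0 _ p0; have n2 : g2 \Po wpoly != 0 by rewrite cmp0 // E2 mulf_neq0.
by rewrite !szX ?mulf_neq0 ?polyX_eq0 // !ltnS E2 lec.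
Qed.

Lemma horner_nat (n : nat) (x : rat) : (n%:R : {poly rat}).[x] = n%:R.
Proof. by rewrite -polyC_natr hornerC. Qed.

Definition hornerE_ring :=
  (horner_exp, hornerD, hornerN, hornerZ, hornerM, hornerX, hornerC, horner_nat).

Lemma horner_sqr (g0 g1 g2 : {poly rat}) (w : rat) :
  [/\ (sqr_coord0 'X g0 g1 g2).[w] = sqr_coord0 w g0.[w] g1.[w] g2.[w],
      (sqr_coord1 'X g0 g1 g2).[w] = sqr_coord1 w g0.[w] g1.[w] g2.[w] &
      (sqr_coord2 g0 g1 g2).[w] = sqr_coord2 g0.[w] g1.[w] g2.[w]].
Proof. by rewrite /sqr_coord0 /sqr_coord1 /sqr_coord2; split; rewrite !hornerE_ring. Qed.

(** Infinite descent on the degree of A - sB in s, with one branch for each class of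
    [descent_class]. *)
Lemma no_pole (t0 : nat) (A B S : {poly rat}) : (2 < t0)%N -> ~ is_form t0%:R ->
  coprimep A B -> B != 0 -> B.[t0%:R^-1] = 0 ->
  'X * B * (A ^+ 3 - A * B ^+ 2 + 'X * B ^+ 3) != S ^+ 2.
Proof.
move=> t2 nform; have [n] := ubnP (size (of_coords A (- B) 0)).
elim: n A B S => // n IHn A B S sizeAB cAB B0; set w0 := t0%:R^-1 => Bw0.
apply/eqP => E; have t0n : t0%:R != 0 :> rat by rewrite pnatr_eq0; lia.
have w00 : 0 < w0 by rewrite invr_gt0 ltr0n; lia.
have w0n : w0 != 0 by rewrite lt0r_neq0.
have w03 : 3 * w0 <= 1.
  by rewrite ler_pdivrMr ?ltr0n ?mul1r ?(ler_nat _ 3) // (ltn_trans _ t2).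
have A0 := coprimep_no_common_root _ _ _ _ cAB Bw0.
have Bn : (- B).[w0] = 0 by rewrite hornerN Bw0 oppr0.
have [c [k [g [c0 kin Ef]]]] := descent_class realalg _ _ _ _ w00 w03 cAB B0 Bw0 E.
have [g0 [g1 [g2 Eg]]] := of_coords_surj g.
pose z0 := sqr_coord0 'X g0 g1 g2; pose z1 := sqr_coord1 'X g0 g1 g2.
pose z2 := sqr_coord2 g0 g1 g2.
have Eg2 : g ^+ 2 = of_coords z0 z1 z2 by rewrite Eg of_coords_sqr.
have [H0 H1 H2] := horner_sqr g0 g1 g2 w0.
rewrite -/z0 -/z1 -/z2 in H0 H1 H2.
move: kin Ef; rewrite Eg2 !inE => /or4P[] /eqP->.
- rewrite mul1r of_coordsZ => /of_coords_inj[EA EB Ez2].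
  have {Ez2} z20 : z2 = 0.
    by apply: (scalerI c0); rewrite scaler0.
  set N := norm3 'X g0 g1 g2.
  have N2 : N ^+ 2 = norm3 'X z0 z1 z2 by rewrite /N -norm3_sqr.
  have Cne : A ^+ 3 - A * B ^+ 2 + 'X * B ^+ 3 != 0.
    apply: contra_neq A0 => C0; apply/eqP.
    suff : A.[w0] ^+ 3 == 0 by rewrite expf_eq0.
    by apply/eqP; rewrite -(horner0 w0) -C0 !hornerE_ring Bw0; ring.
  (* Taking norms to Q[w] in A - sB = c g^2. *)
  have EC : A ^+ 3 - A * B ^+ 2 + 'X * B ^+ 3 = c%:P ^+ 3 * N ^+ 2.
    transitivity (norm3 'X A (- B) 0); first by rewrite /norm3; ring.
    by rewrite N2 z20 EA EB /norm3 -!mul_polyC; ring.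
  have cN : c%:P * N != 0.
    rewrite mulf_neq0 ?polyC_eq0 //.
    by apply: contra_neq Cne => h; rewrite EC h expr0n mulr0.
  have [q [Eq _]] : exists q, c%:P * B * 'X = q ^+ 2 /\ S = q * (c%:P * N).
    by apply: poly_eqmul_sqr cN _; rewrite -E EC; ring.
  have X0 : ('X : {poly rat}) != 0 by rewrite polyX_eq0.
  have /dvdpP[b Eb] : 'X %| q.
    have : 'X %| q ^+ 2 by rewrite -Eq dvdp_mull.
    by rewrite -['X]subr0 !dvdp_XsubCl rootE horner_exp expf_eq0.
  have {}Eq : c%:P * B = 'X * b ^+ 2.
    by apply: (mulIf X0); rewrite Eq Eb; ring.
  have b0 : b != 0.
    apply: contra_neq B0 => bz; have cP : c%:P != 0 by rewrite polyC_eq0.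
    by apply: (mulfI cP); rewrite mulr0 Eq bz; ring.
  have Ez1 : c%:P ^+ 2 * z1 = - ('X * b ^+ 2).
    by rewrite -Eq -[c%:P ^+ 2]/(c%:P * c%:P) -mulrA [c%:P * z1]mul_polyC -EB; ring.
  have cP2 : c%:P ^+ 2 != 0 by rewrite expf_neq0 // polyC_eq0.
  (* The combination g1 z2 - g2 z1 eliminates g0 and leaves the cubic form of the curve at (g1,
     g2). *)
  have Ecubic : c%:P ^+ 2 * (g1 ^+ 3 - g1 * g2 ^+ 2 + 'X * g2 ^+ 3) = 'X * b ^+ 2 * g2.
    transitivity (c%:P ^+ 2 * (g1 * z2 - z1 * g2)).
      by rewrite /z1 /z2 /sqr_coord1 /sqr_coord2; ring.
    rewrite z20 mulr0 sub0r mulrN mulrA Ez1; ring.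
  have g2n : g2 != 0.
    apply/negP => /eqP g2z; have g1z : g1 = 0.
      apply/eqP; rewrite -sqrf_eq0; apply/eqP.
      by rewrite -z20 /z2 /sqr_coord2 g2z; ring.
    move: Ez1; rewrite /z1 /sqr_coord1 g1z g2z => h.
    have : 'X * b ^+ 2 != 0 by rewrite mulf_neq0 ?expf_neq0.
    by rewrite -oppr_eq0 -h; apply/negP; rewrite negbK; apply/eqP; ring.
  have bw : b.[w0] = 0.
    have : (c%:P * B).[w0] = 0 by rewrite hornerM Bw0 mulr0.
    rewrite Eq !hornerE_ring => /eqP; rewrite mulf_eq0 (negPf w0n) expf_eq0 /=.
    by move/eqP.
  have cubw : g1.[w0] ^+ 3 - g1.[w0] * g2.[w0] ^+ 2 + w0 * g2.[w0] ^+ 3 = 0.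
    have : (c%:P ^+ 2 * (g1 ^+ 3 - g1 * g2 ^+ 2 + 'X * g2 ^+ 3)).[w0] = 0.
      by rewrite Ecubic !hornerE_ring bw; ring.
    rewrite !hornerE_ring => /eqP; rewrite mulf_eq0 expf_eq0 (negPf c0) /=.
    by move/eqP.
  (* The halved point is (g1/g2, ...); it still has a pole at w0. *)
  have g2w : g2.[w0] = 0.
    apply/eqP/negPn/negP => g2wn; have /eqP[] := cubic_no_root t0 (t0%:R * g1.[w0] / g2.[w0]) t2.
    transitivity (t0%:R ^+ 3 / g2.[w0] ^+ 3 *
      (g1.[w0] ^+ 3 - g1.[w0] * g2.[w0] ^+ 2 + w0 * g2.[w0] ^+ 3)).
      by rewrite /w0; field; rewrite g2wn t0n.
    by rewrite cubw mulr0.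
  have g1w : g1.[w0] = 0.
    move: cubw; rewrite g2w => h; apply/eqP; suff : g1.[w0] ^+ 3 == 0 by rewrite expf_eq0.
    by rewrite -h; apply/eqP; ring.
  have g0w : g0.[w0] != 0.
    apply: contra_neq A0 => h; rewrite EA hornerZ H0 h g1w g2w /sqr_coord0; ring.
  pose d := gcdp g1 g2; have d0 : d != 0 by rewrite gcdp_eq0 (negPf g2n) andbF.
  have dw : d.[w0] = 0 by apply/eqP; rewrite -rootE root_gcd !rootE g1w g2w eqxx.
  pose p1 := g1 %/ d; pose p2 := g2 %/ d.
  have E1 : g1 = p1 * d by rewrite divpK // dvdp_gcdl.
  have E2 : g2 = p2 * d by rewrite divpK // dvdp_gcdr.
  have cop : coprimep p1 p2 by rewrite coprimep_div_gcd // g2n orbT.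
  have p2n : p2 != 0 by apply: contra_neq g2n => h; rewrite E2 h mul0r.
  (* With d divided out, z2 = 0 says that 2 g0 p2 is a multiple of d, which vanishes at w0 while g0
     does not. *)
  have p2w : p2.[w0] = 0.
    have h : d * (2 * g0 * p2 + d * (p1 ^+ 2 + p2 ^+ 2)) = 0.
      by rewrite -z20 /z2 /sqr_coord2 E1 E2; ring.
    move/eqP: h; rewrite mulf_eq0 (negPf d0) /= => /eqP/(congr1 (fun p => p.[w0])).
    rewrite !hornerE_ring dw mul0r addr0 => /eqP.
    by rewrite !mulf_eq0 (negPf g0w) /= => /eqP.
  (* Multiplied by w g2, the right side of [Ecubic] becomes (w b g2)^2; removing d^4 yields the
     curve equation for p1/p2. *)
  have [S' [ES' _]] : exists q, 'X * p2 * (p1 ^+ 3 - p1 * p2 ^+ 2 + 'X * p2 ^+ 3) = q ^+ 2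
      /\ (c^-1)%:P * 'X * b * g2 = q * d ^+ 2.
    apply: poly_eqmul_sqr; first by rewrite expf_neq0.
    apply: (mulfI cP2).
    transitivity ('X * g2 * (c%:P ^+ 2 * (g1 ^+ 3 - g1 * g2 ^+ 2 + 'X * g2 ^+ 3))).
      by rewrite E1 E2; ring.
    have cc : c%:P * (c^-1)%:P = 1 by rewrite -polyCM divff.
    rewrite Ecubic; transitivity ((c%:P * (c^-1)%:P) ^+ 2 * ('X * b * g2) ^+ 2); last by ring.
    by rewrite cc; ring.
  have := IHn p1 p2 S' _ cop p2n p2w; rewrite ES' eqxx => /(_ _)/negP; apply=> //.
  have gn : of_coords g0 g1 g2 != 0.
    apply: contra_neq g2n => gz; have [] // := of_coords_inj g0 g1 g2 0 0 0.
    by rewrite gz /of_coords comp_poly0 !mulr0 !addr0.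
  apply: leq_trans (size_descent _ _ _ _ _ _ E1 E2 d0 gn) _; rewrite -Eg.
  have Ef : of_coords A (- B) 0 = c *: g ^+ 2.
    by rewrite Eg2 of_coordsZ -EA -EB z20 scaler0.
  move: sizeAB; rewrite Ef size_scale //; have := size_exp g 2.
  have : (0 < size g)%N by rewrite lt0n size_poly_eq0 Eg.
  have : (0 < size (g ^+ 2)%R)%N by rewrite lt0n size_poly_eq0 expf_neq0 // Eg.
  move: (size (g ^+ 2)) (size g) => x y; clear -x y n; lia.
(* Class w: both A and B would vanish at w = 0. *)
- rewrite of_coords_wpoly of_coordsZ => /of_coords_inj[EA EB _].
  have := coprimep_no_common_root _ _ _ 0 cAB; rewrite -[B]opprK EA EB.
  by rewrite !hornerE_ring !mul0r !mulr0 oppr0 eqxx => /(_ erefl).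
- rewrite mulrBl mul1r of_coordsX of_coordsB of_coordsZ => /of_coords_inj[EA EB EC].
  have {EA} EA : A.[w0] = c * (- (w0 * z2.[w0]) - z0.[w0]) by rewrite EA !hornerE_ring.
  have {EB} EB : z0.[w0] + z2.[w0] - z1.[w0] = 0.
    by apply: (mulfI c0); rewrite mulr0 -Bn EB !hornerE_ring.
  have {EC} EC : z1.[w0] - z2.[w0] = 0.
    by apply: (mulfI c0); rewrite mulr0 -(horner0 w0) EC !hornerE_ring.
  have zz1 : z1.[w0] = z2.[w0] by apply: subr0_eq.
  have zz0 : z0.[w0] = 0 by rewrite -[RHS]EB zz1 addrK.
  have z2n : z2.[w0] != 0.
    by apply: contra_neq A0 => h; rewrite EA h zz0 mulr0 oppr0 addr0 mulr0.
  (* Class s - 1: over w0, g^2 = z2 s(s + 1). The witnesses are the coordinates of (1 - s) g, whose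
     square is z2 w0 (1 - s). *)
  apply: nform; apply: (@halving_is_form t0 (g0.[w0] + w0 * g2.[w0])
    (g1.[w0] - g0.[w0] - g2.[w0]) (g2.[w0] - g1.[w0]) _ _ z2n); rewrite -/w0 ?(ltn_trans _ t2) //.
  + transitivity (z0.[w0] + 2 * w0 * z2.[w0] - w0 * z1.[w0]); last by rewrite zz0 zz1; ring.
    by rewrite H0 H1 H2 /sqr_coord0 /sqr_coord1 /sqr_coord2; ring.
  + transitivity (2 * (z1.[w0] - z0.[w0] - z2.[w0]) - w0 * z2.[w0]); last by rewrite zz0 zz1; ring.
    by rewrite H0 H1 H2 /sqr_coord0 /sqr_coord1 /sqr_coord2; ring.
  + transitivity (2 * (z2.[w0] - z1.[w0]) + z0.[w0]); last by rewrite zz0 zz1; ring.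
    by rewrite H0 H1 H2 /sqr_coord0 /sqr_coord1 /sqr_coord2; ring.
- have dist (q : {poly rat}) : 'X * ('X + 1) * q = 'X * ('X * q) + 'X * q by ring.
  rewrite dist !of_coordsX of_coordsD of_coordsZ => /of_coords_inj[EA EB EC].
  have {EA} EA : A.[w0] = c * (- (w0 * z1.[w0]) - w0 * z2.[w0]) by rewrite EA !hornerE_ring.
  have {EB} EB : z1.[w0] - w0 * z2.[w0] + (z0.[w0] + z2.[w0]) = 0.
    apply: (mulfI c0); rewrite mulr0 -Bn EB !hornerE_ring; ring.
  have {EC} EC : z0.[w0] + z2.[w0] + z1.[w0] = 0.
    by apply: (mulfI c0); rewrite mulr0 -(horner0 w0) EC !hornerE_ring.
  have zz2 : z2.[w0] = 0.
    by apply: (mulfI w0n); rewrite mulr0 -[RHS]EC; apply: subr0_eq; rewrite -[RHS]oppr0 -EB; ring.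
  have zz1 : z1.[w0] = - z0.[w0] by apply: subr0_eq; rewrite -[RHS]EC zz2; ring.
  (* Class s(s + 1): over w0, g^2 = z0 (1 - s), so g itself is the required root, with constant
     z0/w0. *)
  have z0n : z0.[w0] / w0 != 0.
    rewrite mulf_neq0 ?invr_eq0 //.
    by apply: contra_neq A0 => h; rewrite EA zz1 zz2 h; ring.
  apply: nform; apply: (@halving_is_form t0 g0.[w0] g1.[w0] g2.[w0] _ _ z0n);
    rewrite -/w0 ?divfK ?(ltn_trans _ t2) //.
  + by rewrite -zz1 H1.
  + by rewrite -zz2 H2.
Qed.

(** * Specialization of rational functions *)

Local Notation tofrac := (@FracField.tofrac _).
Local Open Scope quotient_scope.

Lemma pi_frac_denom (R : idomainType) (r : {ratio R}) :
  \pi_({fraction R}) r * tofrac \d_r = tofrac \n_r.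
Proof.
unlock FracField.tofrac; rewrite -[LHS]FracField.pi_mul; apply/eqmodP.
rewrite /= FracField.equivfE /FracField.mulf.
by rewrite !numden_Ratio ?mulr1 ?oner_neq0 ?denom_ratioP // mulrC.
Qed.
Local Close Scope quotient_scope.

Lemma rden_neq0 f : rden f != 0.
Proof.
rewrite /rden; have := denom_ratioP (repr f); move: (repr f).1 (repr f).2 => n d d0.
by apply: contra_neq d0 => h; rewrite -(divpK (dvdp_gcdr n d)) h mul0r.
Qed.

Lemma coprime_rnum_rden f : coprimep (rnum f) (rden f).
Proof. by rewrite /rnum /rden coprimep_div_gcd // denom_ratioP orbT. Qed.

Lemma rden_mul f : f * tofrac (rden f) = tofrac (rnum f).
Proof.
have E : f * tofrac (repr f).2 = tofrac (repr f).1 by rewrite -pi_frac_denom reprK.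
rewrite /rnum /rden; have := denom_ratioP (repr f).
move: E; move: (repr f).1 (repr f).2 => n d E d0.
have g0 : gcdp n d != 0 by rewrite gcdp_eq0 (negPf d0) andbF.
have tg0 : tofrac (gcdp n d) != 0 by rewrite tofrac_eq0.
apply: (mulIf tg0); rewrite -mulrA -!tofracM.
by rewrite !divpK ?dvdp_gcdl ?dvdp_gcdr.
Qed.

(** Regularity and value can be read off any fraction whose denominator is nonzero at t, reduced or
    not. *)
Lemma regular_frac (t : rat) (f : Qt) (n d : {poly rat}) :
  d.[t] != 0 -> f * tofrac d = tofrac n -> regular_at t f /\ eval_at t f = n.[t] / d.[t].
Proof.
move=> dt E; have {}E : rnum f * d = n * rden f.
  apply/eqP; rewrite -tofrac_eq !tofracM -E -rden_mul; apply/eqP; ring.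
have Et := congr1 (fun p => p.[t]) E; rewrite /= !hornerM in Et.
have reg : (rden f).[t] != 0.
  apply/eqP => h; have := coprimep_no_common_root _ _ _ _ (coprime_rnum_rden f) h.
  move/eqP: Et; rewrite h mulr0 mulf_eq0 (negPf dt) orbF => /eqP ->.
  by rewrite eqxx.
split=> //; rewrite /eval_at; apply: (mulIf dt); rewrite divfK //.
by apply: (mulIf reg); rewrite -Et mulrAC divfK.
Qed.

Lemma regularD t f g : regular_at t f -> regular_at t g ->
  regular_at t (f + g) /\ eval_at t (f + g) = eval_at t f + eval_at t g.
Proof.
rewrite {1 2}/regular_at => rf rg.
have [|| -> ->] := @regular_frac t (f + g) (rnum f * rden g + rnum g * rden f) (rden f * rden g).
- by rewrite hornerM mulf_neq0.
- by rewrite tofracD !tofracM -!rden_mul; ring.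
by split=> //; rewrite /eval_at !(hornerD, hornerM); field; rewrite rf rg.
Qed.

Lemma regularM t f g : regular_at t f -> regular_at t g ->
  regular_at t (f * g) /\ eval_at t (f * g) = eval_at t f * eval_at t g.
Proof.
rewrite {1 2}/regular_at => rf rg.
have [|| -> ->] := @regular_frac t (f * g) (rnum f * rnum g) (rden f * rden g).
- by rewrite hornerM mulf_neq0.
- by rewrite !tofracM -!rden_mul; ring.
by split=> //; rewrite /eval_at !hornerM; field; rewrite rf rg.
Qed.

Lemma regular_tofrac t p : regular_at t (tofrac p) /\ eval_at t (tofrac p) = p.[t].
Proof.
have [|| -> ->] := @regular_frac t (tofrac p) p 1; rewrite ?hornerC ?oner_neq0 //.
  by rewrite tofrac1 mulr1.
by rewrite divr1.
Qed.

Lemma regularN t f : regular_at t f ->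
  regular_at t (- f) /\ eval_at t (- f) = - eval_at t f.
Proof.
move=> rf; have [rm em] := regular_tofrac t (-1).
have [r e] := regularM _ _ _ rm rf; move: r e.
by rewrite em tofracN tofrac1 mulN1r hornerN hornerC mulN1r.
Qed.

Lemma regular_sqrt t f : regular_at t (f ^+ 2) -> regular_at t f.
Proof.
move=> r2; apply/negP => /eqP h.
have E : rnum f ^+ 2 * rden (f ^+ 2) = rnum (f ^+ 2) * rden f ^+ 2.
  by apply/eqP; rewrite -tofrac_eq !tofracM -!rden_mul; apply/eqP; ring.
have := coprimep_no_common_root _ _ _ _ (coprime_rnum_rden f) h.
have := congr1 (fun p => p.[t]) E; rewrite /= hornerM horner_exp hornerM horner_exp h expr0n mulr0.
by move/eqP; rewrite mulf_eq0 (negPf r2) orbF expf_eq0 /= => ->.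
Qed.

(* w^n p(1/w): passes from polynomials in t to polynomials in w = 1/t. *)
Definition rev_poly (n : nat) (p : {poly rat}) : {poly rat} := \poly_(i < n.+1) p`_(n - i).

Lemma horner_rev_poly n (p : {poly rat}) (x : rat) : x != 0 -> (size p <= n.+1)%N ->
  (rev_poly n p).[x] = x ^+ n * p.[x^-1].
Proof.
move=> x0 sp; rewrite horner_poly (horner_coef_wide _ sp) mulr_sumr (reindex_inj rev_ord_inj) /=.
apply: eq_bigr => i _; have lein : (i <= n)%N by rewrite -ltnS.
rewrite subSS subKn // mulrCA; congr (_ * _).
apply: (mulfI (expf_neq0 i x0)); rewrite -exprD subnKC // exprVn mulrCA.
by rewrite divff ?mulr1 // expf_neq0.
Qed.

(** The kernel of specialization is trivial: no affine point falls into the [None] branch of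
    [sigma]. *)
Lemma no_pole_Qt (t0 : nat) x y : (2 < t0)%N -> ~ is_form t0%:R ->
  on_E_Qt (Some (x, y)) -> regular_at t0%:R x && regular_at t0%:R y.
Proof.
move=> t2 nform E; pose t : rat := t0%:R.
have t0n : t != 0 by rewrite pnatr_eq0; lia.
pose p := rnum x; pose q := rden x; pose r := rnum y; pose u := rden y.
have cpq : coprimep p q := coprime_rnum_rden x.
have cru : coprimep r u := coprime_rnum_rden y.
have q0 : q != 0 := rden_neq0 x; have u0 : u != 0 := rden_neq0 y.
pose cub := p ^+ 3 - 'X ^+ 2 * p * q ^+ 2 + 'X ^+ 2 * q ^+ 3.
have E1 : r ^+ 2 * q ^+ 3 = u ^+ 2 * cub.
  apply/eqP; rewrite -tofrac_eq /cub !(tofracM, tofracD, tofracN) -!rden_mul.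
  rewrite -/q -/u -/tQ; apply/eqP; rewrite /on_E_Qt in E.
  by transitivity (y ^+ 2 * (tofrac u ^+ 2 * tofrac q ^+ 3)); [ring|rewrite E; ring].
have [qt|qt] := eqVneq q.[t] 0; last first.
  rewrite /regular_at -/q -/u -/t qt /=; apply/negP => /eqP ut.
  have := coprimep_no_common_root _ _ _ _ cru ut.
  have /eqP := congr1 (fun f => f.[t]) E1.
  rewrite /= hornerM !horner_exp hornerM horner_exp ut expr0n mul0r.
  by rewrite mulf_eq0 !expf_eq0 (negPf qt) /= orbF => ->.
exfalso; have pt := coprimep_no_common_root _ _ _ _ cpq qt.
have [rho [Erho _]] : exists rho, q * cub = rho ^+ 2 /\ r * q ^+ 2 = rho * u.
  apply: poly_eqmul_sqr u0 _.
  by transitivity (q * (u ^+ 2 * cub)); [ring|rewrite -E1; ring].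
pose n := (size p + size q + size rho)%N.
have szp : (size p <= n.+1)%N by rewrite /n; lia.
have szq : (size q <= n.+1)%N by rewrite /n; lia.
have szr : (size rho <= (n + n).+3)%N by rewrite /n; lia.
(* X = w x with x = p/q. Multiplying q [cub] = rho^2 by w^(4n + 4) gives the equation in w, whence
   the exponent 2n + 2 for rho. *)
pose A0 := 'X * rev_poly n p; pose B0 := rev_poly n q; pose S0 := rev_poly (n + n).+2 rho.
have ES0 : 'X * B0 * (A0 ^+ 3 - A0 * B0 ^+ 2 + 'X * B0 ^+ 3) = S0 ^+ 2.
  apply: poly_eq_nz_eval => z z0; rewrite /A0 /B0 /S0 !hornerE_ring !horner_rev_poly //.
  have := congr1 (fun f => f.[z^-1]) Erho; rewrite /= /cub !hornerE_ring => Ez.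
  rewrite [RHS]exprMn -Ez (_ : z ^+ (n + n).+2 = z ^+ 2 * (z ^+ n) ^+ 2); last first.
    by rewrite -exprM -exprD; congr (_ ^+ _); lia.
  by move: (z ^+ n) p.[_] q.[_] => zn a b; clear -z0; field.
have B0n : B0 != 0.
  apply: contra_neq q0 => h; apply: poly_eq_nz_eval => z z0.
  have := horner_rev_poly n q z^-1; rewrite invr_eq0 invrK => /(_ z0 szq).
  rewrite -/B0 h horner0 => /esym/eqP; rewrite mulf_eq0 expf_eq0 invr_eq0 (negPf z0) andbF /=.
  by rewrite horner0 => /eqP.
have tv0 : t^-1 != 0 by rewrite invr_eq0.
have Bt : B0.[t^-1] = 0 by rewrite /B0 horner_rev_poly // invrK qt mulr0.
have At : A0.[t^-1] != 0.
  by rewrite /A0 hornerM hornerX horner_rev_poly // invrK !mulf_neq0 // expf_neq0.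
(* Common factors are removed; since A0(1/t0) is nonzero, so is d(1/t0), and the reduced B keeps its
   zero. *)
pose d := gcdp A0 B0; have d0 : d != 0 by rewrite gcdp_eq0 (negPf B0n) andbF.
have EA : A0 = (A0 %/ d) * d by rewrite divpK // dvdp_gcdl.
have EB : B0 = (B0 %/ d) * d by rewrite divpK // dvdp_gcdr.
have cop : coprimep (A0 %/ d) (B0 %/ d) by rewrite coprimep_div_gcd // B0n orbT.
set A := A0 %/ d in EA cop; set B := B0 %/ d in EB cop.
have Bn : B != 0 by apply: contra_neq B0n => h; rewrite EB h mul0r.
have dt : d.[t^-1] != 0 by apply: contra_neq At => h; rewrite EA hornerM h mulr0.
have Bt' : B.[t^-1] = 0.
  by move/eqP: Bt; rewrite EB hornerM mulf_eq0 (negPf dt) orbF => /eqP.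
have [S [ES _]] : exists S,
    'X * B * (A ^+ 3 - A * B ^+ 2 + 'X * B ^+ 3) = S ^+ 2 /\ S0 = S * d ^+ 2.
  apply: poly_eqmul_sqr; first by rewrite expf_neq0.
  by rewrite -ES0 EA EB; ring.
by have := no_pole _ _ _ S t2 nform cop Bn Bt'; rewrite ES eqxx.
Qed.

(* The third intersection with the line through (x1, y1) and (x2, - y2). *)
Lemma chord_on_curve (F : fieldType) (a b x1 y1 x2 y2 : F) : x1 != x2 ->
  y1 ^+ 2 = x1 ^+ 3 - a * x1 + b -> y2 ^+ 2 = x2 ^+ 3 - a * x2 + b ->
  let l := (y1 + y2) / (x1 - x2) in let x3 := l ^+ 2 - x1 - x2 in
  (y1 + l * (x3 - x1)) ^+ 2 = x3 ^+ 3 - a * x3 + b.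
Proof.
move=> x12 E1 E2 l x3; have D0 : x1 - x2 != 0 by rewrite subr_eq0.
have Ey2 : y2 = l * (x1 - x2) - y1 by rewrite /l divfK // addrC addKr.
have Eb : b = y1 ^+ 2 - x1 ^+ 3 + a * x1 by rewrite E1; ring.
have Ea : a = x1 ^+ 2 + x1 * x2 + x2 ^+ 2 - 2 * l * y1 + l ^+ 2 * (x1 - x2).
  apply: (mulfI D0); apply: subr0_eq.
  transitivity ((x2 ^+ 3 - a * x2 + b) - y2 ^+ 2); last by rewrite E2 subrr.
  by rewrite {}Ey2 {}Eb; ring.
rewrite Eb /x3 Ea; ring.
Qed.

Lemma sigma_injective (t0 : nat) (P Q : option (Qt * Qt)) :
  (2 < t0)%N -> ~ is_form t0%:R -> on_E_Qt P -> on_E_Qt Q ->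
  sigma t0%:R P = sigma t0%:R Q -> P = Q.
Proof.
move=> t2 nform; case: P => [[x1 y1]|]; case: Q => [[x2 y2]|] // EP EQ; last first.
- by rewrite /sigma (no_pole_Qt _ _ _ t2 nform EQ).
- by rewrite /sigma (no_pole_Qt _ _ _ t2 nform EP).
have /andP[rx1 ry1] := no_pole_Qt _ _ _ t2 nform EP.
have /andP[rx2 ry2] := no_pole_Qt _ _ _ t2 nform EQ.
rewrite /sigma rx1 ry1 rx2 ry2 /=; set t : rat := t0%:R in rx1 ry1 rx2 ry2 *; case=> Ex Ey.
(* The specialized point is not 2-torsion. *)
have y10 : eval_at t y1 != 0.
  apply/eqP => y0; have /eqP[] := cubic_no_root t0 (eval_at t x1) t2; rewrite -/t.
  have [rt et] := regular_tofrac t 'X; rewrite -/tQ hornerX in rt et.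
  have [ryy eyy] := regularM _ _ _ ry1 ry1.
  have [rxx exx] := regularM _ _ _ rx1 rx1.
  have [rxxx exxx] := regularM _ _ _ rx1 rxx.
  have [rtt ett] := regularM _ _ _ rt rt.
  have [rttx ettx] := regularM _ _ _ rtt rx1.
  have [rn en] := regularN _ _ rttx.
  have [rs es] := regularD _ _ _ rxxx rn.
  have [_ e] := regularD _ _ _ rs rtt.
  transitivity (eval_at t y1 * eval_at t y1); last by rewrite y0 mulr0.
  rewrite -eyy (_ : y1 * y1 = x1 * (x1 * x1) + - (tQ * tQ * x1) + tQ * tQ); last first.
    by move: EP; rewrite /on_E_Qt !exprS expr0 !mulr1.
  by rewrite e es en ettx exxx exx ett et; ring.
have [Exx|nx] := eqVneq x1 x2.
  subst x2; have : (y1 - y2) * (y1 + y2) = 0.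
    by rewrite -subr_sqr; move: EP EQ; rewrite /on_E_Qt => -> ->; rewrite subrr.
  move/eqP; rewrite mulf_eq0 subr_eq0 => /orP[/eqP-> //|]; rewrite addr_eq0 => /eqP Ey12.
  have [_ e] := regularN _ _ ry2; move: y10; rewrite {1}Ey12 e -Ey => /eqP[].
  have : eval_at t y1 = - eval_at t y1 by rewrite {1}Ey12 e -Ey.
  lra.
(* Otherwise P - Q is a nonzero point of the kernel. *)
exfalso; pose l := (y1 + y2) / (x1 - x2); pose x3 := l ^+ 2 - x1 - x2.
have E3 : on_E_Qt (Some (x3, y1 + l * (x3 - x1))) by apply: chord_on_curve.
have /andP[rx3 _] := no_pole_Qt _ _ _ t2 nform E3.
have rl : regular_at t l.
  apply: regular_sqrt; rewrite (_ : l ^+ 2 = x3 + (x1 + x2)); last by rewrite /x3; ring.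
  have [r12 _] := regularD _ _ _ rx1 rx2.
  by have [] := regularD _ _ _ rx3 r12.
have [rn en] := regularN _ _ rx2.
have [rd ed] := regularD _ _ _ rx1 rn.
have [_ em] := regularM _ _ _ rl rd.
have [_ es] := regularD _ _ _ ry1 ry2.
(* At t0, l (x1 - x2) = y1 + y2 reads 0 = 2 y1(t0), because l has no pole there. *)
have := es; rewrite -[y1 + y2](divfK (x := x1 - x2)) ?subr_eq0 // em ed en -Ex -Ey.
by move=> h; move/eqP: y10; apply; lra.
Qed.

(** * Density *)

Local Notation isqrt := PeanoNat.Nat.sqrt.

Lemma isqrt_sqr n : isqrt (n * n) = n.
Proof. exact: PeanoNat.Nat.sqrt_square. Qed.

Lemma isqrt_spec n : (isqrt n * isqrt n <= n < (isqrt n).+1 * (isqrt n).+1)%N.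
Proof.
have := PeanoNat.Nat.sqrt_spec n (PeanoNat.Nat.le_0_l n).
by case=> /ssrnat.leP -> /ssrnat.ltP ->.
Qed.

(* By is_form_int, t = 4 b^3 (2a + 3b) or t = a^3 (3a + 4b) with a^2 - 2b^2 = +-1.  The code
   records which formula (with v = |b| or |a|), the sign of the norm, and whether a and b
   have the same sign. *)
Definition form_value (code : bool * bool * bool) (v : nat) : nat :=
  let: (first, pos, same) := code in
  let e : int := (-1) ^+ ~~ pos in let s : int := (-1) ^+ ~~ same in
  if first then
    let a : int := isqrt (absz (2 * v%:Z ^+ 2 + e)) in
    absz (4 * v%:Z ^+ 3 * (2 * (s * a) + 3 * v%:Z))
  else
    let b : int := isqrt (absz ((v%:Z ^+ 2 - e) %/ 2)%Z) in
    absz (v%:Z ^+ 3 * (3 * v%:Z + 4 * (s * b))).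

(** Both expressions are even in (a, b), so only the relative sign counts; the norm equation
    recovers the other coordinate as an exact square root. Since v^2 divides k > 0, v is at most
    sqrt k. *)
Lemma form_value_spec (k : nat) : (0 < k)%N -> is_form k%:R ->
  exists code v, k = form_value code v /\ (v <= isqrt k)%N.
Proof.
move=> k0; rewrite pmulrn => /is_form_int[a [b [nrm Hk]]].
have bound (v : nat) : (v * v %| k)%N -> (v <= isqrt k)%N.
  move=> /(dvdn_leq k0) h; have /andP[_ h2] := isqrt_spec k; nia.
have sgnE (x : int) : exists (c : bool), x = (-1) ^+ c * (absz x)%:Z.
  by exists (x < 0); rewrite -intEsign.
have [c Ea] := sgnE a; have [d Eb] := sgnE b.
have [pos Enrm] : exists pos : bool, a ^+ 2 - 2 * b ^+ 2 = (-1) ^+ ~~ pos.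
  by case: nrm => ->; [exists true|exists false].
have sq (x : int) : x ^+ 2 = (absz x * absz x)%N%:Z.
  by rewrite mulnn -abszX gez0_abs ?sqr_ge0.
have sgnM : (-1) ^+ (~~ (c == d)) = (-1) ^+ c * (-1) ^+ d :> int.
  by case: (c) (d) => [] [].
have sgn1 (i : bool) : (-1) ^+ i = 1 :> int \/ (-1) ^+ i = -1 :> int.
  by case: i; [right|left].
have kE : k = absz k%:Z by [].
case: Hk => Hk.
- exists (true, pos, c == d), (absz b); split.
    rewrite /form_value /=.
    have -> : 2 * (absz b)%:Z ^+ 2 + (-1) ^+ (~~ pos) = a ^+ 2.
      by rewrite -Enrm [b ^+ 2]sq PoszM; ring.
    rewrite sq absz_nat isqrt_sqr kE Hk {1 2}Eb {1}Ea.
    by rewrite sgnM; case: (sgn1 c) (sgn1 d) => -> [] ->; congr absz; ring.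
  apply: bound; rewrite kE Hk.
  rewrite (_ : 4 * _ * _ = b * b * (4 * b * (2 * a + 3 * b))); last by ring.
  by rewrite !abszM -mulnA -mulnA mulnA dvdn_mulr.
- exists (false, pos, c == d), (absz a); split.
    rewrite /form_value /=.
    have -> : (((absz a)%:Z ^+ 2 - (-1) ^+ ~~ pos) %/ 2)%Z = b ^+ 2.
      have -> : (absz a)%:Z ^+ 2 - (-1) ^+ (~~ pos) = b ^+ 2 * 2.
        by rewrite -Enrm [a ^+ 2]sq PoszM; ring.
      by rewrite mulzK.
    rewrite sq absz_nat isqrt_sqr kE Hk {1 2}Ea {1}Eb.
    by rewrite sgnM; case: (sgn1 c) (sgn1 d) => -> [] ->; congr absz; ring.
  apply: bound; rewrite kE Hk.
  rewrite (_ : a ^+ 3 * _ = a * a * (a * (3 * a + 4 * b))); last by ring.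
  by rewrite !abszM dvdn_mulr.
Qed.

Definition countB (n : nat) : nat := count (fun k => ~~ asbool (inT k)) (iota 0 n.+1).

Lemma countTB n : (countT n + countB n = n.+1)%N.
Proof.
have -> : countT n = count (fun k => asbool (inT k)) (iota 0 n.+1).
  rewrite -sumn_count sumnE big_map -[iota 0 n.+1]/(index_iota 0 n.+1).
  by rewrite big_mkord.
by rewrite /countB count_predC size_iota.
Qed.

(** There are 8 codes for each v up to sqrt n, plus the values 0, 1, 2. *)
Lemma countB_le n : (countB n <= 8 * (isqrt n).+1 + 3)%N.
Proof.
rewrite /countB -size_filter.
pose codes := [seq (x, z) | x <- [seq (y, y') | y <- [:: true; false], y' <- [:: true; false]],
  z <- [:: true; false]].
pose s := [seq form_value c v | c <- codes, v <- iota 0 (isqrt n).+1] ++ [:: 0; 1; 2].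
have -> : (8 * (isqrt n).+1 + 3 = size s)%N by rewrite size_cat size_allpairs size_iota.
apply: uniq_leq_size; first by rewrite filter_uniq ?iota_uniq.
move=> k; rewrite mem_filter mem_iota add0n ltnS => /andP[/asboolPn nT kn].
rewrite mem_cat; have [k2|k2] := leqP k 2.
  by apply/orP; right; case: k k2 {nT kn} => [|[|[|]]].
have : is_form k%:R by apply/notP => nf; apply: nT.
case/form_value_spec => [|c [v [kE vk]]]; first by lia.
apply/orP; left; apply/allpairsP; exists (c, v); split; last exact: kE.
  by case: (c) => [[[] []] []].
rewrite mem_iota add0n ltnS (leq_trans vk) //.
by have := PeanoNat.Nat.sqrt_le_mono k n; move/(_ (ssrnat.leP kn)) => /ssrnat.leP.
Qed.

Lemma density_one : has_density 1.
Proof.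
(* For r at least 1, 1 + 8(r + 1) + 3 is at most 20 r, and 20 r / n is at most 20 / r. *)
move=> eps eps0; pose M := (Num.bound (20 / eps)).+1.
exists (M * M)%N => n nM; set r := isqrt n.
have /andP[rn nr] := isqrt_spec n; rewrite -/r in rn nr.
have Mr : (M <= r)%N by nia.
have n0 : (0 < n)%N by rewrite /M in nM; nia.
have nn0 : 0 < n%:R :> rat by rewrite ltr0n.
have hB := countB_le n; rewrite -/r in hB.
have hT := countTB n.
(* The count runs over the n + 1 values 0, ..., n but is divided by n, hence the extra 1. *)
have -> : (countT n)%:R / n%:R - 1 = (1 - (countB n)%:R) / n%:R :> rat.
  have : (countT n)%:R + (countB n)%:R = n%:R + 1 :> rat by rewrite -natrD hT natr1.
  move=> h; rewrite (_ : (countT n)%:R = n%:R + 1 - (countB n)%:R); last by lra.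
  by field; rewrite lt0r_neq0.
rewrite normrM normfV (gtr0_norm nn0) ltr_pdivrMr //.
have h1 : `|1 - (countB n)%:R| <= 20 * r%:R :> rat.
  rewrite (le_trans (ler_normB _ _)) // normr1 normr_nat -natr1 addrC.
  have : ((countB n).+1 <= 20 * r)%N by rewrite /M in Mr; lia.
  by rewrite -(ler_nat rat) natrM -natr1.
apply: le_lt_trans h1 _.
have hM : 20 < eps * M%:R.
  rewrite -ltr_pdivrMl // mulrC; apply: (lt_le_trans (archi_boundP _)).
    by rewrite divr_ge0 // ltW.
  by rewrite ler_nat.
have h2 : M%:R <= r%:R :> rat by rewrite ler_nat.
have h3 : r%:R * r%:R <= n%:R :> rat by rewrite -natrM ler_nat.
have r0 : 0 < r%:R :> rat by rewrite ltr0n; rewrite /M in Mr; lia.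
move: hM h2 h3 r0; move: (M%:R : rat) (r%:R : rat) (n%:R : rat) => x y z hx hy hz y0.
apply: (@lt_le_trans _ _ (eps * x * y)); first by rewrite (ltr_pM2r y0).
rewrite -mulrA (ler_pM2l eps0); apply: le_trans hz.
by rewrite (ler_pM2r y0).
Qed.

Theorem theorem4p8 :
  has_density 1 /\
  forall t0 : nat, inT t0 ->
    forall P Q : option (Qt * Qt), on_E_Qt P -> on_E_Qt Q ->
      sigma t0%:R P = sigma t0%:R Q -> P = Q.
Proof.
split; first exact: density_one.
by move=> t0 [t2 nform] P Q; apply: sigma_injective.
Qed.
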